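(* Let $\mathcal{M}=\langle S,(S_i)_{i\in I},(\succeq_i)_{i\in I},R,V\rangle$ be a finite Trust model, $s\in S$, and $\alpha\in\mathcal{L}_T$. Let $n=|S|$, let $r$ be the number of pairs $(s,v)$ with $sRv$, let $k$ be the number of support subformulas (of the form $\varphi\rightsquigarrow\psi$) of $\alpha$, and let $k'$ be the number of belief modalities in $\alpha$ plus the number of atomic propositions in $\alpha$ plus the number of connectives in $\alpha$. Then whether $\mathcal{M},s\models\alpha$ can be decided with complexity $O(k\cdot n^2+(k+k')\cdot(n+r))$.
   Context: Propositional formulas: $\varphi::=\bot\mid p\mid\varphi\land\varphi\mid\varphi\lor\varphi\mid\varphi\to\varphi\mid\varphi\leftrightarrow\varphi\mid\neg\varphi$. $\mathcal{L}_T$: $\alpha::=\varphi\mid\varphi\rightsquigarrow\varphi\mid B(\alpha)\mid\alpha*\alpha\mid\neg\alpha$ ($\varphi$ propositional, $*\in\{\land,\lor,\to,\leftrightarrow\}$). A Trust model is $\mathcal{M}=\langle S,(S_i)_{i\in I},(\succeq_i)_{i\in I},R,V\rangle$: $R\subseteq S\times S$ serial and transitive; $(S_i)$ a partition of $S$; $\succeq_i\subseteq S_i\times S_i$ arbitrary; $V$ maps variables to subsets of $S$; and for each $i$ and propositional $\varphi$, $\|\varphi\|_i\neq\emptyset\Rightarrow\mathit{most}(\|\varphi\|_i)\neq\emptyset$, with $\|\varphi\|_i=\{v\in S_i:\mathcal{M},v\models\varphi\}$, $\mathit{most}(X)=\{s\in X:\forall v\in X\,(v\succeq_i s\Rightarrow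 s\succeq_i v)\}$. Truth: $s\models p$ iff $s\in V(p)$; Boolean clauses as usual; $s\models\varphi\rightsquigarrow\psi$ iff $\mathit{most}(\|\varphi\|_i)\subseteq\|\psi\|_i$ where $s\in S_i$; $s\models B(\alpha)$ iff $v\models\alpha$ for every $v$ with $sRv$. *)

(* Defs.v *)
From mathcomp Require Import all_boot.
Set Implicit Arguments. Unset Strict Implicit. Unset Printing Implicit Defensive.

Inductive pform : Type :=
| PBot | PVar of nat | PAnd of pform & pform | POr of pform & pform
| PImp of pform & pform | PIff of pform & pform | PNeg of pform.

Inductive tform : Type :=
| TProp of pform
| TSup of pform & pform
| TB of tform
| TAnd of tform & tform | TOr of tform & tform
| TImp of tform & tform | TIff of tform & tform | TNeg of tform.

(* Trust models (finite set of states S, partition given by part).    *)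
(* S_i = { u | part u = i };  pref i is >=_i, contained in S_i x S_i. *)
Section Sem.
Variable S : finType.

Fixpoint psat (val : nat -> pred S) (f : pform) (u : S) : bool :=
  match f with
  | PBot => false
  | PVar p => val p u
  | PAnd f1 f2 => psat val f1 u && psat val f2 u
  | POr f1 f2 => psat val f1 u || psat val f2 u
  | PImp f1 f2 => psat val f1 u ==> psat val f2 u
  | PIff f1 f2 => psat val f1 u == psat val f2 u
  | PNeg f1 => ~~ psat val f1 u
  end.

Definition ext (I : eqType) (part : S -> I) (val : nat -> pred S) (i : I)
  (f : pform) : pred S := fun u => (part u == i) && psat val f u.

Definition most (pr : rel S) (X : pred S) : pred S :=
  fun u => X u && [forall v, X v ==> pr v u ==> pr u v].
End Sem.

Record trust_model (S : finType) (I : eqType) := TrustModel {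
  part : S -> I;
  pref : I -> rel S;
  acc : rel S;
  val : nat -> pred S;
  pref_dom : forall i u v, pref i u v -> (part u == i) && (part v == i);
  acc_serial : forall u, exists v, acc u v;
  acc_trans : transitive acc;
  smooth : forall (i : I) (f : pform),
      (exists u, ext part val i f u) -> exists u, most (pref i) (ext part val i f) u
}.

Fixpoint tsat (S : finType) (I : eqType) (M : trust_model S I) (a : tform) (s : S)
  : bool :=
  match a with
  | TProp f => psat (val M) f s
  | TSup f g =>
      [forall u, most (pref M (part M s)) (ext (part M) (val M) (part M s) f) u
                 ==> psat (val M) g u]
  | TB b => [forall v, acc M s v ==> tsat M b v]
  | TAnd b c => tsat M b s && tsat M c s
  | TOr b c => tsat M b s || tsat M c s
  | TImp b c => tsat M b s ==> tsat M c s
  | TIff b c => tsat M b s == tsat M c s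
  | TNeg b => ~~ tsat M b s
  end.

Fixpoint pvars (f : pform) : seq nat :=
  match f with
  | PBot => [::] | PVar p => [:: p]
  | PAnd f1 f2 | POr f1 f2 | PImp f1 f2 | PIff f1 f2 => pvars f1 ++ pvars f2
  | PNeg f1 => pvars f1
  end.

Fixpoint tvars (a : tform) : seq nat :=
  match a with
  | TProp f => pvars f
  | TSup f g => pvars f ++ pvars g
  | TB b | TNeg b => tvars b
  | TAnd b c | TOr b c | TImp b c | TIff b c => tvars b ++ tvars c
  end.

Fixpoint pconn (f : pform) : nat :=
  match f with
  | PBot | PVar _ => 0
  | PAnd f1 f2 | POr f1 f2 | PImp f1 f2 | PIff f1 f2 => (pconn f1 + pconn f2).+1
  | PNeg f1 => (pconn f1).+1
  end.

Fixpoint tconn (a : tform) : nat :=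
  match a with
  | TProp f => pconn f
  | TSup f g => pconn f + pconn g
  | TB b => tconn b
  | TNeg b => (tconn b).+1
  | TAnd b c | TOr b c | TImp b c | TIff b c => (tconn b + tconn c).+1
  end.

Fixpoint nbel (a : tform) : nat :=
  match a with
  | TProp _ | TSup _ _ => 0
  | TB b => (nbel b).+1
  | TNeg b => nbel b
  | TAnd b c | TOr b c | TImp b c | TIff b c => nbel b + nbel c
  end.

Fixpoint nsup (a : tform) : nat :=
  match a with
  | TProp _ => 0
  | TSup _ _ => 1
  | TB b | TNeg b => nsup b
  | TAnd b c | TOr b c | TImp b c | TIff b c => nsup b + nsup c
  end.

Definition kprime (a : tform) : nat := nbel a + size (undup (tvars a)) + tconn a.

(* Machine model: unit-cost RAM with addition, truncated subtraction,  *)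
(* indirect addressing and conditional jumps; memory nat -> nat.       *)
Inductive instr : Type :=
| IConst of nat & nat
| IAdd of nat & nat & nat
| ISub of nat & nat & nat
| ILoad of nat & nat
| IStore of nat & nat
| IJz of nat & nat
| IJmp of nat
| IHalt.

Definition program := seq instr.
Definition memory := nat -> nat.
Definition upd (m : memory) (a v : nat) : memory := fun x => if x == a then v else m x.

(* one step from (pc, m); None when the machine has halted
   (IHalt, or pc outside the program) *)
Definition step (P : program) (c : nat * memory) : option (nat * memory) :=
  let: (pc, m) := c in
  match nth IHalt P pc with
  | IConst d k => Some (pc.+1, upd m d k)
  | IAdd d a b => Some (pc.+1, upd m d (m a + m b))
  | ISub d a b => Some (pc.+1, upd m d (m a - m b))
  | ILoad d a => Some (pc.+1, upd m d (m (m a)))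
  | IStore a b => Some (pc.+1, upd m (m a) (m b))
  | IJz a l => Some (if m a == 0 then l else pc.+1, m)
  | IJmp l => Some (l, m)
  | IHalt => None
  end.

Fixpoint exec (P : program) (t : nat) (c : nat * memory) : option memory :=
  match step P c with
  | None => Some c.2
  | Some c' => if t is t'.+1 then exec P t' c' else None
  end.

(* Input encoding of (M, s, alpha).  States are numbered by their      *)
(* position in enum S.  Layout (addresses):                            *)
(*  0 : output cell (initially 0)    1 : n    2 : index of s           *)
(*  3 : address of root formula node                                   *)
(*  4 : table (n pointers) of rows of the same-class 0/1 matrix        *)
(*  5 : table (n pointers) of rows of the preference 0/1 matrix,       *)
(*      entry (u,v) = [u >=_{i} v] with i the class of u               *)
(*  6 : table (n pointers) of adjacency lists of R: [deg; v1; ..; vd]  *)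
(*  7 : table (m pointers) of rows of the valuation, row j = V(p_j)    *)
(*  8 : m = 1 + largest variable index in alpha (0 if none)            *)
(*  9 : total length of the input (free memory starts there)           *)
(* Formula nodes are 3 cells [tag; arg1; arg2], args are absolute      *)
(* addresses of child nodes (or the variable index for PVar).          *)
Definition ptrs (base : nat) (rows : seq (seq nat)) : seq nat :=
  [seq base + sumn (map size (take i rows)) | i <- iota 0 (size rows)].

Definition encode_rows (start : nat) (rows : seq (seq nat)) : seq nat :=
  ptrs (start + size rows) rows ++ flatten rows.

Fixpoint psz (f : pform) : nat :=
  match f with
  | PBot | PVar _ => 1
  | PAnd f1 f2 | POr f1 f2 | PImp f1 f2 | PIff f1 f2 => (psz f1 + psz f2).+1
  | PNeg f1 => (psz f1).+1
  end.

Fixpoint tsz (a : tform) : nat :=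
  match a with
  | TProp f => (psz f).+1
  | TSup f g => (psz f + psz g).+1
  | TB b | TNeg b => (tsz b).+1
  | TAnd b c | TOr b c | TImp b c | TIff b c => (tsz b + tsz c).+1
  end.

Definition enc_bin (tag b : nat) (n1 : nat) (e1 e2 : nat -> seq nat) : seq nat :=
  [:: tag; b + 3; b + 3 + 3 * n1] ++ e1 (b + 3) ++ e2 (b + 3 + 3 * n1).

Fixpoint enc_p (f : pform) (b : nat) : seq nat :=
  match f with
  | PBot => [:: 0; 0; 0]
  | PVar p => [:: 1; p; 0]
  | PAnd f1 f2 => enc_bin 2 b (psz f1) (enc_p f1) (enc_p f2)
  | POr f1 f2 => enc_bin 3 b (psz f1) (enc_p f1) (enc_p f2)
  | PImp f1 f2 => enc_bin 4 b (psz f1) (enc_p f1) (enc_p f2)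
  | PIff f1 f2 => enc_bin 5 b (psz f1) (enc_p f1) (enc_p f2)
  | PNeg f1 => [:: 6; b + 3; 0] ++ enc_p f1 (b + 3)
  end.

Fixpoint enc_t (a : tform) (b : nat) : seq nat :=
  match a with
  | TProp f => [:: 7; b + 3; 0] ++ enc_p f (b + 3)
  | TSup f g => enc_bin 8 b (psz f) (enc_p f) (enc_p g)
  | TB c => [:: 9; b + 3; 0] ++ enc_t c (b + 3)
  | TAnd c d => enc_bin 10 b (tsz c) (enc_t c) (enc_t d)
  | TOr c d => enc_bin 11 b (tsz c) (enc_t c) (enc_t d)
  | TImp c d => enc_bin 12 b (tsz c) (enc_t c) (enc_t d)
  | TIff c d => enc_bin 13 b (tsz c) (enc_t c) (enc_t d)
  | TNeg c => [:: 14; b + 3; 0] ++ enc_t c (b + 3)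
  end.

Section Encoding.
Variables (S : finType) (I : eqType) (M : trust_model S I) (s : S) (a : tform).

Definition st_idx (u : S) : nat := index u (enum S).
Definition rows_cls := [seq [seq nat_of_bool (part M u == part M v) | v <- enum S] | u <- enum S].
Definition rows_pref := [seq [seq nat_of_bool (pref M (part M u) u v) | v <- enum S] | u <- enum S].
Definition rows_acc := [seq #|[pred v | acc M u v]| :: [seq st_idx v | v <- enum S & acc M u v]
                       | u <- enum S].
Definition nvars := foldr maxn 0 (map succn (tvars a)).
Definition rows_val := [seq [seq nat_of_bool (val M j v) | v <- enum S] | j <- iota 0 nvars].

Definition addrA := 10.
Definition blockA := encode_rows addrA rows_cls.
Definition addrP := addrA + size blockA.
Definition blockP := encode_rows addrP rows_pref.
Definition addrR := addrP + size blockP.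
Definition blockR := encode_rows addrR rows_acc.
Definition addrV := addrR + size blockR.
Definition blockV := encode_rows addrV rows_val.
Definition addrF := addrV + size blockV.
Definition blockF := enc_t a addrF.
Definition input_len := addrF + size blockF.

Definition input : seq nat :=
  [:: 0; #|S|; st_idx s; addrF; addrA; addrP; addrR; addrV; nvars; input_len]
  ++ blockA ++ blockP ++ blockR ++ blockV ++ blockF.

Definition input_mem : memory := fun x => nth 0 input x.
End Encoding.

Definition nacc (S : finType) (I : eqType) (M : trust_model S I) : nat :=
  #|[pred p : S * S | acc M p.1 p.2]|.

(* Main.v *)
(* The formula nodes are processed from the last to the first, so children come
   before their parents, and the tag of each node is overwritten by a pointer to
   its truth row, an array of n bits.  A variable points to its row of the
   valuation, bottom to a fresh zone of zeroed memory and an embedded propositional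
   formula to the row of its child, all in constant time; a connective costs O(n), a
   belief O(n + r) and a support formula O(n^2).  The constant-time nodes number
   O(k + k' + 1) because the leaves are bounded by the binary nodes.  The machine
   code is compiled from a small imperative language whose running time is
   preserved up to the size of the code. *)
Require Import Defs.
From mathcomp Require Import all_boot zify.
Set Implicit Arguments. Unset Strict Implicit. Unset Printing Implicit Defensive.

(** The bound itself dictates the constant-time leaves: for [TProp PBot] both [k] and [k'] are 0, so
    the whole run has a constant budget and not even one row of n bits can be written. Moreover [k']
    counts distinct variables, so repeated occurrences have to be charged to the connectives that
    join them. A second obstacle is that one program must serve all inputs, while the input fills
    every low address. This is why a source language with virtual registers is put between the
    checker and the machine: it hides that address arithmetic, and its clock differs from that of
    the machine by a factor depending on the program text alone. *)

(** * Runs of code fragments on the RAM *)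

Fixpoint nsteps (P : program) (k : nat) (c c' : nat * memory) : Prop :=
  if k is k'.+1 then exists2 c1, step P c = Some c1 & nsteps P k' c1 c' else c = c'.

Lemma nsteps_add P k1 k2 c1 c2 c3 :
  nsteps P k1 c1 c2 -> nsteps P k2 c2 c3 -> nsteps P (k1 + k2) c1 c3.
Proof.
elim: k1 c1 => [|k IH] c1 /=; first by move=> ->.
by case=> c4 H1 H2 H3; exists c4 => //; apply: IH.
Qed.

(** [exec] answers only once the machine halts, so it does not compose. Fragments are chained with
    [nsteps], and only the complete run is turned into [exec], with any sufficient fuel. *)
Lemma exec_nsteps P k t c c' :
  nsteps P k c c' -> step P c' = None -> k <= t -> exec P t c = Some c'.2.
Proof.
elim: k t c => [|k IH] t c /=.
  by move=> -> H _; case: t => [|t] /=; rewrite H.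
by case=> c1 H1 H2 H3; case: t => // t Ht /=; rewrite H1; apply: IH.
Qed.

(** Jump targets are absolute, so a fragment is studied at its place inside the whole program
    instead of in isolation. *)
Definition code_at (P : program) (pc : nat) (code : seq instr) : Prop :=
  forall i, i < size code -> nth IHalt P (pc + i) = nth IHalt code i.

Lemma code_at_cat P pc c1 c2 :
  code_at P pc (c1 ++ c2) -> code_at P pc c1 /\ code_at P (pc + size c1) c2.
Proof.
move=> H; split=> i Hi.
  by rewrite H ?size_cat ?nth_cat ?Hi //; lia.
rewrite -addnA H ?size_cat ?nth_cat; last lia.
by rewrite ltnNge leq_addr /= addKn.
Qed.

Lemma code_at_self c1 c2 : code_at (c1 ++ c2) 0 c1.
Proof. by move=> i Hi; rewrite add0n nth_cat Hi. Qed.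

Lemma upd_eq m x v : upd m x v x = v.
Proof. by rewrite /upd eqxx. Qed.

Lemma upd_neq m x y v : y != x -> upd m x v y = m y.
Proof. by rewrite /upd => /negbTE ->. Qed.

Definition straight (i : instr) : bool :=
  match i with IJz _ _ | IJmp _ | IHalt => false | _ => true end.

Definition sstep (m : memory) (i : instr) : memory :=
  match i with
  | IConst d k => upd m d k
  | IAdd d a b => upd m d (m a + m b)
  | ISub d a b => upd m d (m a - m b)
  | ILoad d a => upd m d (m (m a))
  | IStore a b => upd m (m a) (m b)
  | _ => m
  end.

Lemma nsteps_straight P pc code m :
  code_at P pc code -> all straight code ->
  nsteps P (size code) (pc, m) (pc + size code, foldl sstep m code).
Proof.
elim: code pc m => [|i code IH] pc m H /=; first by rewrite addn0.
case/andP=> Hi Hc; exists (pc.+1, sstep m i).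
  by have := H 0 isT; rewrite addn0 /= => ->; case: i {H} Hi.
rewrite -addSnnS; apply: IH => // j Hj.
by rewrite addSnnS H.
Qed.

(** * The source language and its timed semantics *)

(* Virtual register [j] lives at address [L + j], where [L], the length of the
   input, is read from cell 9; the registers [20 .. 39] hold intermediate values
   of expressions.  The cells 0 and 4 serve as accumulators: the constant
   address [addrA] stored in cell 4 is never read. *)
Inductive expr : Type :=
| EReg of nat | ENat of nat | EBase | EAdd of expr & expr | ESub of expr & expr
| ELoad of expr.

Coercion ENat : nat >-> expr.
Declare Scope expr_scope.
Bind Scope expr_scope with expr.
Notation "$ r" := (EReg r) (at level 0, r at level 0, format "$ r") : expr_scope.
Notation "e1 + e2" := (EAdd e1 e2) : expr_scope.
Notation "e1 - e2" := (ESub e1 e2) : expr_scope.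

Inductive cmd : Type :=
| Asg of nat & expr
| Store of expr & expr
| Seq of cmd & cmd
| If of expr & cmd & cmd
| While of expr & cmd.

(** Source programs may read and write these cells only. The others belong to the compiler: the
    accumulators 0 and 4, the input length in 9, and the forty register cells. *)
Definition cell_free (L x : nat) : bool :=
  [&& x != 0, x != 4, x != 9 & (x < L) || (L + 40 <= x)].

Section Semantics.
Variable L : nat.

(** The first component holds the registers, the second the memory cells. *)
Definition state := (memory * memory)%type.

Fixpoint ev (st : state) (e : expr) : nat :=
  match e with
  | EReg j => st.1 j
  | ENat k => k
  | EBase => L
  | EAdd e1 e2 => ev st e1 + ev st e2
  | ESub e1 e2 => ev st e1 - ev st e2
  | ELoad e1 => st.2 (ev st e1)
  end.

Fixpoint safe (st : state) (e : expr) : bool :=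
  match e with
  | EReg _ | ENat _ | EBase => true
  | EAdd e1 e2 | ESub e1 e2 => safe st e1 && safe st e2
  | ELoad e1 => safe st e1 && cell_free L (ev st e1)
  end.

(** Expressions are free on this clock: their machine time depends on the program text only and is
    absorbed by the factor [W] of [comp_run]. *)
Inductive run : cmd -> state -> nat -> state -> Prop :=
| RunAsg st r e : safe st e -> run (Asg r e) st 1 (upd st.1 r (ev st e), st.2)
| RunStore st e1 e2 : safe st e1 -> safe st e2 -> cell_free L (ev st e1) ->
    run (Store e1 e2) st 1 (st.1, upd st.2 (ev st e1) (ev st e2))
| RunSeq st1 st2 st3 t1 t2 c1 c2 :
    run c1 st1 t1 st2 -> run c2 st2 t2 st3 -> run (Seq c1 c2) st1 (t1 + t2) st3
| RunIf st st' t e c1 c2 : safe st e ->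
    run (if ev st e == 0 then c2 else c1) st t st' -> run (If e c1 c2) st t.+1 st'
| RunWhile0 st e c : safe st e -> ev st e = 0 -> run (While e c) st 1 st
| RunWhile st1 st2 st3 t1 t2 e c : safe st1 e -> ev st1 e != 0 ->
    run c st1 t1 st2 -> run (While e c) st2 t2 st3 ->
    run (While e c) st1 (t1 + t2).+1 st3.

End Semantics.

(** * Compilation to the RAM *)

Definition virt (r j : nat) : seq instr := [:: IConst r j; IAdd r r 9].

(** The value ends up in cell 0. A left operand waits in virtual register 20 + d, and d grows only
    in the right operand, during whose evaluation that register is occupied. *)
Fixpoint comp_expr (e : expr) (d : nat) : seq instr :=
  match e with
  | EReg j => virt 0 j ++ [:: ILoad 0 0]
  | ENat k => [:: IConst 0 k]
  | EBase => virt 0 0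
  | EAdd e1 e2 =>
      comp_expr e1 d ++ virt 4 (20 + d) ++ IStore 4 0 :: comp_expr e2 d.+1 ++
      virt 4 (20 + d) ++ [:: ILoad 4 4; IAdd 0 4 0]
  | ESub e1 e2 =>
      comp_expr e1 d ++ virt 4 (20 + d) ++ IStore 4 0 :: comp_expr e2 d.+1 ++
      virt 4 (20 + d) ++ [:: ILoad 4 4; ISub 0 4 0]
  | ELoad e1 => comp_expr e1 d ++ [:: ILoad 0 0]
  end.

Fixpoint wf_expr (e : expr) (d : nat) : bool :=
  match e with
  | EReg j => j < 20
  | ENat _ | EBase => true
  | EAdd e1 e2 | ESub e1 e2 => [&& d < 20, wf_expr e1 d & wf_expr e2 d.+1]
  | ELoad e1 => wf_expr e1 d
  end.

(** Defined before [compile] and without a program counter, because forward jump targets need the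
    size of code that is yet to be placed. *)
Fixpoint csize (c : cmd) : nat :=
  match c with
  | Asg _ e => size (comp_expr e 0) + 3
  | Store e1 e2 => size (comp_expr e1 0) + 3 + size (comp_expr e2 1) + 4
  | Seq c1 c2 => csize c1 + csize c2
  | If e c1 c2 => size (comp_expr e 0) + 1 + csize c1 + 1 + csize c2
  | While e c => size (comp_expr e 0) + 1 + csize c + 1
  end.

Fixpoint compile (c : cmd) (pc : nat) : seq instr :=
  match c with
  | Asg r e => comp_expr e 0 ++ virt 4 r ++ [:: IStore 4 0]
  | Store e1 e2 =>
      comp_expr e1 0 ++ virt 4 20 ++ IStore 4 0 :: comp_expr e2 1 ++
      virt 4 20 ++ [:: ILoad 4 4; IStore 4 0]
  | Seq c1 c2 => compile c1 pc ++ compile c2 (pc + csize c1)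
  | If e c1 c2 =>
      let pc1 := pc + size (comp_expr e 0) + 1 in
      let pc2 := pc1 + csize c1 + 1 in
      comp_expr e 0 ++ IJz 0 pc2 :: compile c1 pc1 ++ IJmp (pc2 + csize c2) :: compile c2 pc2
  | While e c1 =>
      let pc1 := pc + size (comp_expr e 0) + 1 in
      comp_expr e 0 ++ IJz 0 (pc1 + csize c1 + 1) :: compile c1 pc1 ++ [:: IJmp pc]
  end.

Fixpoint wf_cmd (c : cmd) : bool :=
  match c with
  | Asg r e => (r < 20) && wf_expr e 0
  | Store e1 e2 => wf_expr e1 0 && wf_expr e2 1
  | Seq c1 c2 => wf_cmd c1 && wf_cmd c2
  | If e c1 c2 => [&& wf_expr e 0, wf_cmd c1 & wf_cmd c2]
  | While e c1 => wf_expr e 0 && wf_cmd c1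
  end.

Lemma size_comp c pc : size (compile c pc) = csize c.
Proof.
elim: c pc => [r e|e1 e2|c1 I1 c2 I2|e c1 I1 c2 I2|e c1 I1] pc /=.
- by rewrite size_cat.
- by rewrite size_cat /= size_cat /=; lia.
- by rewrite size_cat I1 I2.
- by rewrite size_cat /= size_cat /= I1 I2; lia.
by rewrite size_cat /= size_cat /= I1; lia.
Qed.

Lemma straight_expr e d : all straight (comp_expr e d).
Proof.
elim: e d => //= [e1 I1 e2 I2|e1 I1 e2 I2|e1 I1] d; rewrite all_cat I1 //=.
  by rewrite all_cat I2.
by rewrite all_cat I2.
Qed.

Section Compile.
Variable L : nat.
Hypothesis L9 : 9 < L.

(** Cells 0 and 4 and the registers 20 to 39 are left unconstrained, so scratch writes preserve
    [rep]. *)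
Definition rep (m : memory) (st : state) : Prop :=
  [/\ m 9 = L, forall j, j < 20 -> m (L + j) = st.1 j &
      forall x, cell_free L x -> m x = st.2 x].

Lemma rep_upd m st x v : rep m st -> (x == 0) || (x == 4) || (L + 20 <= x < L + 40) ->
  rep (upd m x v) st.
Proof.
case=> H9 HR HF Hx; split=> [|j Hj|y Hy]; rewrite /upd.
- by case: eqP => [?|_] //; lia.
- by case: eqP => [?|_]; [lia|apply: HR].
by case: eqP => [?|_]; [rewrite /cell_free in Hy; lia|apply: HF].
Qed.

Lemma spill m k code : m 9 = L ->
  foldl sstep m (virt 4 k ++ IStore 4 0 :: code) =
  foldl sstep (upd (upd (upd m 4 k) 4 (k + L)) (k + L) (m 0)) code.
Proof. by move=> H9; rewrite foldl_cat /= /upd /= H9. Qed.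

Lemma reload m k i : m 9 = L ->
  foldl sstep m (virt 4 k ++ [:: ILoad 4 4; i]) =
  sstep (upd (upd (upd m 4 k) 4 (k + L)) 4 (m (k + L))) i.
Proof.
move=> H9; rewrite /= /upd /= H9.
by have -> : (k + L == 4) = false by lia.
Qed.

(** The last conjunct strengthens the induction: operands saved at depths below [d] survive the
    evaluation of a subexpression. *)
Lemma comp_exprP e d m st : rep m st -> wf_expr e d -> safe L st e ->
  let m' := foldl sstep m (comp_expr e d) in
  [/\ m' 0 = ev L st e, rep m' st & forall j, j < d -> m' (L + 20 + j) = m (L + 20 + j)].
Proof.
(* Addition and subtraction differ only in the final instruction, so one argument with [iop]
   abstract serves both. *)
have bin op e1 e2 (iop : instr) : 
    (forall m, sstep m iop = upd m 0 (op (m 4) (m 0))) ->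
    (forall d m, rep m st -> wf_expr e1 d -> safe L st e1 ->
      let m' := foldl sstep m (comp_expr e1 d) in
      [/\ m' 0 = ev L st e1, rep m' st &
          forall j, j < d -> m' (L + 20 + j) = m (L + 20 + j)]) ->
    (forall d m, rep m st -> wf_expr e2 d -> safe L st e2 ->
      let m' := foldl sstep m (comp_expr e2 d) in
      [/\ m' 0 = ev L st e2, rep m' st &
          forall j, j < d -> m' (L + 20 + j) = m (L + 20 + j)]) ->
    forall d m, rep m st -> [&& d < 20, wf_expr e1 d & wf_expr e2 d.+1] ->
      safe L st e1 && safe L st e2 ->
      let m' := foldl sstep m (comp_expr e1 d ++ virt 4 (20 + d) ++
         IStore 4 0 :: comp_expr e2 d.+1 ++ virt 4 (20 + d) ++ [:: ILoad 4 4; iop]) in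
      [/\ m' 0 = op (ev L st e1) (ev L st e2), rep m' st &
          forall j, j < d -> m' (L + 20 + j) = m (L + 20 + j)].
  move=> Hop I1 I2 {}d {}m Hm /and3P [Hd W1 W2] /andP [S1 S2] /=.
  rewrite foldl_cat.
  have [E1 R1 F1] := I1 _ _ Hm W1 S1.
  set m1 := foldl _ m _ in E1 R1 F1 *.
  have H9 : m1 9 = L by case: R1.
  rewrite spill // E1 foldl_cat.
  set m2 := upd (upd _ _ _) _ _.
  have R2 : rep m2 st.
    apply: rep_upd; last lia.
    by apply: rep_upd => //; apply: rep_upd.
  have [E3 R3 F3] := I2 _ _ R2 W2 S2.
  set m3 := foldl _ m2 _ in E3 R3 F3 *.
  have H9' : m3 9 = L by case: R3.
  have T3 : m3 (20 + d + L) = ev L st e1.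
    have -> : 20 + d + L = L + 20 + d by lia.
    rewrite F3 // /m2 /upd; case: eqP => // ?; lia.
  rewrite reload // Hop T3.
  split.
  - by rewrite /upd /= E3.
  - by do 4 (apply: rep_upd => //).
  move=> j Hj; do 4 (rewrite upd_neq; last lia).
  rewrite F3; last lia.
  rewrite /m2; do 3 (rewrite upd_neq; last lia).
  exact: F1.
elim: e d m => [j|k||e1 I1 e2 I2|e1 I1 e2 I2|e1 I1] d m Hm.
- move=> Hj _; have [H9 HR _] := Hm.
  split; last by move=> k _ /=; do 3 (rewrite upd_neq; last lia).
    have -> : foldl sstep m (virt 0 j ++ [:: ILoad 0 0]) 0 = upd (upd m 0 j) 0 (j + L) (j + L).
      by rewrite /= /upd /= H9.
    by do 2 (rewrite upd_neq; last lia); rewrite addnC HR.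
  by do 3 apply: rep_upd => //.
- move=> _ _ /=; split => //; first by apply: rep_upd.
  by move=> j _; rewrite upd_neq; last lia.
- move=> _ _ /=; split.
  + by rewrite /upd /=; case: Hm.
  + by do 2 apply: rep_upd => //.
  by move=> j _; do 2 (rewrite upd_neq; last lia).
- by apply: (bin addn).
- by apply: (bin subn).
move=> /= W /andP [S1 S2]; rewrite foldl_cat /=.
have [E1 R1 F1] := I1 _ _ Hm W S1; set m1 := foldl _ _ _ in E1 R1 F1 *.
split.
- by rewrite /upd /= E1; case: R1 => _ _; apply.
- by apply: rep_upd.
by move=> j Hj; rewrite upd_neq ?F1 //; lia.
Qed.

(** Each unit of source time is charged [W] machine steps. The test of an [If] or [While] and the
    jumps around its body are paid by the unit of that command. Since [W] is any bound above the
    code size, subcommands and further iterations share the same [W]. *)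
Theorem comp_run c st t st' : run L c st t st' ->
  forall P pc m W, wf_cmd c -> code_at P pc (compile c pc) -> csize c < W -> rep m st ->
  exists k m', [/\ nsteps P k (pc, m) (pc + csize c, m'), rep m' st' & k <= W * t].
Proof.
have expr_steps e P pc code m st0 :
    code_at P pc (comp_expr e 0 ++ code) -> wf_expr e 0 -> rep m st0 -> safe L st0 e ->
    exists m', [/\ nsteps P (size (comp_expr e 0)) (pc, m) (pc + size (comp_expr e 0), m'),
      m' 0 = ev L st0 e & rep m' st0].
  move=> /code_at_cat [Hc _] We Hm Se.
  have [E R _] := comp_exprP Hm We Se.
  by exists (foldl sstep m (comp_expr e 0)); split=> //; apply: nsteps_straight (straight_expr _ _).
elim=> {c st t st'}.
- move=> st r e Se P pc m W /andP [Hr We] Hc HW Hm.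
  have Hs : all straight (compile (Asg r e) pc) by rewrite /= all_cat straight_expr.
  have := nsteps_straight m Hc Hs.
  rewrite size_comp => H; exists (csize (Asg r e)), (foldl sstep m (compile (Asg r e) pc)).
  split=> //; last lia.
  rewrite [compile _ _]/= foldl_cat.
  have [E R _] := comp_exprP Hm We Se; set m1 := foldl _ m _ in E R *.
  case: R => H9 HR HF.
  rewrite (@spill _ _ [::]) // E [foldl _ _ _]/=.
  split=> [|j Hj|x Hx].
  + by do 3 (rewrite upd_neq; last lia).
  + rewrite /= {1 4}/upd; have -> : (L + j == r + L) = (j == r) by lia.
    by case: eqP => // _; do 2 (rewrite upd_neq; last lia); apply: HR.
  by rewrite /cell_free in Hx; do 3 (rewrite upd_neq; last lia); apply: HF.
- move=> st e1 e2 S1 S2 Fr P pc m W /andP [W1 W2] Hc HW Hm.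
  have Hs : all straight (compile (Store e1 e2) pc).
    by rewrite /= all_cat straight_expr /= all_cat straight_expr.
  have := nsteps_straight m Hc Hs.
  rewrite size_comp => H; exists (csize (Store e1 e2)), (foldl sstep m (compile (Store e1 e2) pc)).
  split=> //; last lia.
  rewrite [compile _ _]/= foldl_cat.
  have [E R _] := comp_exprP Hm W1 S1; set m1 := foldl _ m _ in E R *.
  have H9 : m1 9 = L by case: R.
  rewrite spill // E foldl_cat.
  set m2 := upd (upd _ _ _) _ _.
  have R2 : rep m2 st.
    apply: rep_upd; last lia.
    by apply: rep_upd => //; apply: rep_upd.
  have [E3 R3 F3] := comp_exprP R2 W2 S2.
  set m3 := foldl _ m2 _ in E3 R3 F3 *.
  have H9' : m3 9 = L by case: R3.
  have T3 : m3 (20 + L) = ev L st e1.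
    have -> : 20 + L = L + 20 + 0 by lia.
    rewrite F3 // /m2 /upd; case: eqP => // ?; lia.
  rewrite reload // T3 /=.
  have -> : upd (upd (upd m3 4 20) 4 (20 + L)) 4 (ev L st e1) 4 = ev L st e1 by rewrite upd_eq.
  have -> : upd (upd (upd m3 4 20) 4 (20 + L)) 4 (ev L st e1) 0 = ev L st e2 by rewrite /upd /= E3.
  have [H9'' HR HF] : rep (upd (upd (upd m3 4 20) 4 (20 + L)) 4 (ev L st e1)) st.
    by do 3 (apply: rep_upd => //).
  move: (upd (upd (upd m3 _ _) _ _) _ _) H9'' HR HF => m4 H9'' HR HF.
  have Fr' := Fr; rewrite /cell_free in Fr'.
  split=> [|j Hj|x Hx].
  + by rewrite upd_neq //; lia.
  + by rewrite upd_neq ?HR //; lia.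
  by rewrite /= /upd; case: eqP => // _; apply: HF.
- move=> st1 st2 st3 t1 t2 c1 c2 _ I1 _ I2 P pc m W /= /andP [W1 W2] Hc HW Hm.
  have [Hc1 Hc2] := code_at_cat Hc; rewrite size_comp in Hc2.
  have [|k1 [m1 [K1 R1 L1]]] := I1 P pc m W W1 Hc1 _ Hm; first lia.
  have [|k2 [m2 [K2 R2 L2]]] := I2 P _ m1 W W2 Hc2 _ R1; first lia.
  exists (k1 + k2), m2; split=> //; last by rewrite mulnDr leq_add.
  by rewrite addnA; apply: nsteps_add K1 K2.
- move=> st st' t e c1 c2 Se _ IH P pc m W /= /and3P [We W1 W2] Hc HW Hm.
  have [m1 [K1 E1 R1]] := expr_steps _ _ _ _ _ _ Hc We Hm Se.
  have [_ Hc1] := code_at_cat Hc.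
  have := Hc1 0 isT; rewrite addn0 /= => Hjz.
  rewrite -cat1s in Hc1; have [_ Hc2] := code_at_cat Hc1.
  rewrite [size [:: _]]/= in Hc2.
  have [Hc3 Hc4] := code_at_cat Hc2; rewrite size_comp in Hc4.
  have := Hc4 0 isT; rewrite addn0 /= => Hjmp.
  rewrite -cat1s in Hc4; have [_ Hc5] := code_at_cat Hc4.
  rewrite [size [:: _]]/= in Hc5.
  set n0 := size (comp_expr e 0) in K1 Hjz Hjmp Hc3 Hc5 HW *.
  case E0: (ev L st e == 0) in IH.
    have [|k2 [m2 [K2 R2 L2]]] := IH P _ m1 W W2 Hc5 _ R1; first lia.
    exists (n0 + (1 + k2)), m2; split=> //; last by rewrite mulnS; lia.
    apply: nsteps_add K1 _; exists (pc + n0 + 1 + csize c1 + 1, m1).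
      by rewrite /step Hjz E1 E0.
    by move: K2; congr nsteps; congr pair; lia.
  have [|k2 [m2 [K2 R2 L2]]] := IH P _ m1 W W1 Hc3 _ R1; first lia.
  exists (n0 + (1 + (k2 + 1))), m2; split=> //; last by rewrite mulnS; lia.
  apply: nsteps_add K1 _; apply: nsteps_add (_ : nsteps P 1 _ (pc + n0 + 1, m1)) _.
    by exists (pc + n0 + 1, m1) => //; rewrite /step Hjz E1 E0 addn1.
  apply: nsteps_add K2 _.
  exists (pc + n0 + 1 + csize c1 + 1 + csize c2, m2); first by rewrite /step Hjmp.
  by congr pair; lia.
- move=> st e c Se E0 P pc m W /= /andP [We W1] Hc HW Hm.
  have [m1 [K1 E1 R1]] := expr_steps _ _ _ _ _ _ Hc We Hm Se.
  have [_ Hc1] := code_at_cat Hc.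
  have := Hc1 0 isT; rewrite addn0 /= => Hjz.
  exists (size (comp_expr e 0) + 1), m1; split=> //; last lia.
  apply: nsteps_add K1 _.
  exists (pc + size (comp_expr e 0) + 1 + csize c + 1, m1); first by rewrite /step Hjz E1 E0.
  by congr pair; lia.
move=> st1 st2 st3 t1 t2 e c Se E0 _ IH1 _ IH2 P pc m W /= /andP [We W1] Hc HW Hm.
have [m1 [K1 E1 R1]] := expr_steps _ _ _ _ _ _ Hc We Hm Se.
have [_ Hc1] := code_at_cat Hc.
have := Hc1 0 isT; rewrite addn0 /= => Hjz.
rewrite -cat1s in Hc1; have [_ Hc2] := code_at_cat Hc1.
rewrite [size [:: _]]/= in Hc2.
have [Hc3 Hc4] := code_at_cat Hc2; rewrite size_comp in Hc4.
have := Hc4 0 isT; rewrite addn0 /= => Hjmp.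
set n0 := size (comp_expr e 0) in K1 Hjz Hjmp Hc3 HW *.
have [|k2 [m2 [K2 R2 L2]]] := IH1 P _ m1 W W1 Hc3 _ R1; first lia.
have [|k3 [m3 [K3 R3 L3]]] := IH2 P pc m2 W _ Hc HW R2; first by rewrite /= We.
exists (n0 + (1 + (k2 + (1 + k3)))), m3; split=> //; last by rewrite mulnS mulnDr; lia.
apply: nsteps_add K1 _; apply: nsteps_add (_ : nsteps P 1 _ (pc + n0 + 1, m1)) _.
  by exists (pc + n0 + 1, m1) => //; rewrite /step Hjz E1 (negbTE E0) addn1.
apply: nsteps_add K2 _; apply: nsteps_add (_ : nsteps P 1 _ (pc, m2)) K3.
by exists (pc, m2); rewrite ?/step ?Hjmp.
Qed.
End Compile.

(** * Total correctness triples with a time budget *)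

Section Triples.
Variable L : nat.

Definition tri (c : cmd) (st : state) (T : nat) (Q : state -> Prop) : Prop :=
  exists t st', [/\ run L c st t st', t <= T & Q st'].

Lemma tri_weaken c st T T' (Q Q' : state -> Prop) :
  tri c st T Q -> T <= T' -> (forall st', Q st' -> Q' st') -> tri c st T' Q'.
Proof.
move=> [t [st' [H1 H2 H3]]] HT HQ; exists t, st'; split=> //; last exact: HQ.
exact: leq_trans HT.
Qed.

Lemma tri_asg r e st T (Q : state -> Prop) :
  safe L st e -> Q (upd st.1 r (ev L st e), st.2) -> tri (Asg r e) st T.+1 Q.
Proof. by move=> Hs HQ; exists 1; eexists; split; [apply: RunAsg| |exact: HQ]. Qed.

Lemma tri_store e1 e2 st T (Q : state -> Prop) :
  safe L st e1 -> safe L st e2 -> cell_free L (ev L st e1) ->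
  Q (st.1, upd st.2 (ev L st e1) (ev L st e2)) -> tri (Store e1 e2) st T.+1 Q.
Proof. by move=> H1 H2 H3 HQ; exists 1; eexists; split; [apply: RunStore| |exact: HQ]. Qed.

(** Nesting the second triple in the postcondition of the first turns the rules into a forward
    symbolic execution without intermediate assertions. *)
Lemma tri_seq c1 c2 st T1 T2 Q :
  tri c1 st T1 (fun st1 => tri c2 st1 T2 Q) -> tri (Seq c1 c2) st (T1 + T2) Q.
Proof.
move=> [t1 [st1 [R1 L1 [t2 [st2 [R2 L2 HQ]]]]]].
by exists (t1 + t2), st2; split=> //; [apply: RunSeq R1 R2|apply: leq_add].
Qed.

Lemma tri_asg_seq r e c st T Q :
  safe L st e -> tri c (upd st.1 r (ev L st e), st.2) T Q -> tri (Seq (Asg r e) c) st T.+1 Q.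
Proof. by move=> Hs HQ; rewrite -add1n; apply/tri_seq/tri_asg. Qed.

Lemma tri_store_seq e1 e2 c st T Q :
  safe L st e1 -> safe L st e2 -> cell_free L (ev L st e1) ->
  tri c (st.1, upd st.2 (ev L st e1) (ev L st e2)) T Q -> tri (Seq (Store e1 e2) c) st T.+1 Q.
Proof. by move=> H1 H2 H3 HQ; rewrite -add1n; apply/tri_seq/tri_store. Qed.

Lemma tri_if e c1 c2 st T Q :
  safe L st e -> tri (if ev L st e == 0 then c2 else c1) st T Q -> tri (If e c1 c2) st T.+1 Q.
Proof.
move=> Hs [t [st' [H1 H2 H3]]]; exists t.+1, st'; split=> //.
exact: RunIf.
Qed.

Lemma tri_while e c st T1 T2 Q :
  safe L st e -> ev L st e != 0 -> tri c st T1 (fun st1 => tri (While e c) st1 T2 Q) ->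
  tri (While e c) st (T1 + T2).+1 Q.
Proof.
move=> Hs He [t1 [st1 [R1 L1 [t2 [st2 [R2 L2 HQ]]]]]].
exists (t1 + t2).+1, st2; split=> //; first exact: RunWhile R1 R2.
by rewrite ltnS leq_add.
Qed.

Lemma tri_while0 e c st T (Q : state -> Prop) :
  safe L st e -> ev L st e = 0 -> Q st -> tri (While e c) st T.+1 Q.
Proof. by move=> Hs He HQ; exists 1, st; split=> //; apply: RunWhile0. Qed.

(** The cost of an iteration may depend on its index: summing degrees is what gives a belief node r
    instead of n^2. Each iteration pays 1 for its test, and the last 1 is the failing test. *)
Lemma tri_for (Inv : nat -> state -> Prop) e c m (T : nat -> nat) st :
  (forall j st, j <= m -> Inv j st -> safe L st e && ((ev L st e == 0) == (j == m))) ->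
  (forall j st, j < m -> Inv j st -> tri c st (T j) (Inv j.+1)) ->
  Inv 0 st -> tri (While e c) st (\sum_(j < m) (T j).+1).+1 (Inv m).
Proof.
move=> Hg Hc HI.
(* Induction on the number [d] of iterations left, since a loop unrolls from its front. *)
suff aux d j st1 : j + d = m -> Inv j st1 ->
    tri (While e c) st1 (\sum_(j <= i < m) (T i).+1).+1 (Inv m).
  by rewrite -(big_mkord xpredT (fun j => (T j).+1)); apply: (aux m).
elim: d j st1 => [|d IH] j st1 Hj HIj.
  rewrite addn0 in Hj; subst j; rewrite big_geq //.
  have /andP [Hs] := Hg _ _ (leqnn m) HIj; rewrite eqxx eqb_id => /eqP He.
  exact: tri_while0.
have Hjm : j < m by lia.
have /andP [Hs] := Hg _ _ (ltnW Hjm) HIj; rewrite (ltn_eqF Hjm) => He.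
rewrite big_ltn // addSn; set T2 := \sum_(_ <= _ < _) _.
rewrite -addnS; apply: tri_while => //; first by case: (_ == 0) He.
apply: tri_weaken (Hc _ _ Hjm HIj) (leqnn _) _ => st2; apply: IH; lia.
Qed.

End Triples.

(** * The checker in the source language *)

(* Registers 0 to 4 are constant during the main loop: the number of states, the
   tables of the preference relation, of the accessibility relation and of the
   valuation, and the address of the root node. *)
Notation rN := 0 (only parsing).
Notation rPref := 1 (only parsing).
Notation rAcc := 2 (only parsing).
Notation rVal := 3 (only parsing).
Notation rRoot := 4 (only parsing).
Notation rNode := 5 (only parsing).
Notation rFree := 6 (only parsing).
Notation rTag := 7 (only parsing).
Notation rX := 8 (only parsing).
Notation rY := 9 (only parsing).
Notation rI := 10 (only parsing).
Notation rOut := 11 (only parsing).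
Notation rJ := 12 (only parsing).
Notation rList := 13 (only parsing).
Notation rRow := 14 (only parsing).

Declare Scope cmd_scope.
Bind Scope cmd_scope with cmd.
Delimit Scope cmd_scope with cmd.
Delimit Scope expr_scope with expr.
Arguments Seq (_ _)%_cmd_scope.
Arguments If _%_expr_scope (_ _)%_cmd_scope.
Arguments While _%_expr_scope _%_cmd_scope.
Notation "r ::= e" := (Asg r e%expr) (at level 60, no associativity) : cmd_scope.
Notation "c1 ;; c2" := (Seq c1 c2) (at level 62, right associativity) : cmd_scope.
Local Open Scope cmd_scope.

(** With truncated subtraction on bits, x + y - 1 is conjunction, 1 - (x - y) implication and 1 - (1
    - (x + y)) disjunction. The truth tables below are built in this way. *)
Definition all_loop (bound e : expr) : cmd :=
  rOut ::= 1;; rJ ::= 0;;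
  While (bound - $rJ) (rOut ::= $rOut + e - 1;; rJ ::= $rJ + 1).

(** A bump allocator: rows are laid out from [rFree] upwards and never recycled, so older rows stay
    valid and memory above [rFree] stays zero. *)
Definition map_loop (body : cmd) : cmd :=
  rI ::= 0;;
  While ($rN - $rI) (body;; Store ($rFree + $rI) $rOut;; rI ::= $rI + 1);;
  rRow ::= $rFree;; rFree ::= $rFree + $rN.

(** The tested expression is the distance between tag and [k], zero exactly on equality; hence the
    swapped branches. *)
Definition tag_is (k : nat) (c1 c2 : cmd) : cmd :=
  If (($rTag - k) + (k - $rTag)) c2 c1.

Definition neg_node : cmd := map_loop (rOut ::= 1 - ELoad ($rX + $rI)).

Definition bool_node : cmd :=
  let x := ELoad ($rX + $rI)%expr in
  let y := ELoad ($rY + $rI)%expr in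
  let conj := rOut ::= x + y - 1 in
  let disj := rOut ::= 1 - (1 - (x + y)) in
  let impl := rOut ::= 1 - (x - y) in
  let equiv := rOut ::= 1 - (x - y) - (y - x) in
  map_loop
   (tag_is 2 conj (tag_is 10 conj (tag_is 3 disj (tag_is 11 disj
     (tag_is 4 impl (tag_is 12 impl equiv)))))).

Definition bel_node : cmd :=
  map_loop
   (rList ::= ELoad ($rAcc + $rI);;
    all_loop (ELoad $rList) (ELoad ($rX + ELoad ($rList + 1 + $rJ)))).

Definition pref_cell (u v : expr) : expr := ELoad (ELoad ($rPref + u) + v)%expr.

(* Entry [u] of the first row is 1 iff [u] is a most preferred [phi]-state of its
   class that violates [psi].  Comparable states lie in the same class, so this
   does not require the class matrix. *)
Definition sup_node : cmd :=
  map_loop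
   (all_loop $rN
     (1 - (ELoad ($rX + $rJ) + pref_cell $rJ $rI - 1 - pref_cell $rI $rJ));;
    rOut ::= $rOut + (ELoad ($rX + $rI) - ELoad ($rY + $rI)) - 1);;
  rY ::= $rRow;;
  map_loop (all_loop $rN (1 - (ELoad (ELoad (addrA + $rI) + $rJ) + ELoad ($rY + $rJ) - 1))).

(** The order of the tests keeps the loads meaningful: tags 0 and 1 carry no child address and are
    settled before [rX] is loaded, and [rY] is loaded only for nodes with two children. *)
Definition node_row : cmd :=
  tag_is 0 (rRow ::= $rFree;; rFree ::= $rFree + $rN)
 (tag_is 1 (rRow ::= ELoad ($rVal + ELoad ($rNode + 1)))
 (rX ::= ELoad (ELoad ($rNode + 1));;
  tag_is 7 (rRow ::= $rX)
 (tag_is 6 neg_node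
 (tag_is 14 neg_node
 (tag_is 9 bel_node
 (rY ::= ELoad (ELoad ($rNode + 2));;
  tag_is 8 sup_node bool_node)))))).

Definition node_body : cmd :=
  rNode ::= $rNode - 3;; rTag ::= ELoad $rNode;; node_row;; Store $rNode $rRow.

Definition main_loop : cmd := While ($rNode - $rRoot) node_body.

Definition init : cmd :=
  rN ::= ELoad 1;; rPref ::= ELoad 5;; rAcc ::= ELoad 6;; rVal ::= ELoad 7;;
  rRoot ::= ELoad 3;; rNode ::= EBase;; rFree ::= EBase + 40.

Definition checker : cmd := init;; main_loop.

(** An expression and not a command: compiled expressions leave their value in cell 0, the output
    cell, which no [Store] may touch. *)
Definition answer : expr := ELoad (ELoad $rRoot + ELoad 2)%expr.

Definition checker_program : program := compile checker 0 ++ comp_expr answer 0.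

Lemma wf_checker : wf_cmd checker && wf_expr answer 0.
Proof. by []. Qed.

(** * Correctness of the two loop schemes *)

Definition frame (D : pred nat) (r r' : memory) : Prop := forall k, D k -> r' k = r k.

Lemma all_loopP L bound e m (f : nat -> bool) (st : state) :
  (forall st' : state, st'.2 = st.2 -> frame (predC (pred2 rOut rJ)) st.1 st'.1 ->
     safe L st' bound /\ ev L st' bound = m) ->
  (forall st' : state, st'.2 = st.2 -> frame (predC (pred2 rOut rJ)) st.1 st'.1 ->
     st'.1 rJ < m -> safe L st' e /\ ev L st' e = f (st'.1 rJ)) ->
  tri L (all_loop bound e) st (3 * m + 3)
    (fun st' : state => [/\ st'.2 = st.2, frame (predC (pred2 rOut rJ)) st.1 st'.1 &
                    st'.1 rOut = all f (iota 0 m)]).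
Proof.
move=> Hb He; rewrite addnS; apply: tri_asg_seq => //.
rewrite addnS; apply: tri_asg_seq => //.
pose Inv j (st' : state) := [/\ st'.2 = st.2, frame (predC (pred2 rOut rJ)) st.1 st'.1,
  st'.1 rJ = j & st'.1 rOut = all f (iota 0 j)].
apply: tri_weaken (@tri_for L Inv _ _ m (fun=> 2) _ _ _ _) _ _.
- move=> j st' Hj [E1 E2 E3 E4]; have [S1 S2] := Hb _ E1 E2.
  by rewrite /= S1 S2 E3; apply/eqP; lia.
- move=> j st' Hj [E1 E2 E3 E4]; rewrite -E3 in Hj; have [S1 S2] := He _ E1 E2 Hj.
  apply: tri_asg_seq; first by rewrite /= S1.
  apply: tri_asg => //; split=> //.
  + move=> k /= Hk; rewrite upd_neq ?upd_neq ?E2 //=; lia.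
  + by rewrite /upd /= E3 addn1.
  rewrite -[j.+1]addn1 iotaD all_cat /= /upd /= andbT S2 E3 E4.
  by case: (f j); case: all.
- split=> //= k /= Hk; rewrite upd_neq ?upd_neq //=; lia.
- by rewrite sum_nat_const card_ord; lia.
by move=> st' [].
Qed.

(** The numbering of the registers serves these frames: registers below 10 are inputs of a body,
    [rI] is register 10, and what a body may change starts at 11. *)
Lemma map_loopP L body n (g : nat -> bool) T (st : state) :
  st.1 rN = n -> L + 40 <= st.1 rFree ->
  (forall i (st' : state), i < n -> frame (fun k => k < 10) st.1 st'.1 -> st'.1 rI = i ->
     (forall x, x < st.1 rFree -> st'.2 x = st.2 x) ->
     tri L body st' (T i) (fun st2 : state =>
       [/\ st2.2 = st'.2, frame (fun k => k < 11) st'.1 st2.1 & st2.1 rOut = g i])) ->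
  tri L (map_loop body) st (\sum_(i < n) (T i + 3) + 4) (fun st' : state =>
    [/\ frame [pred k | (k < 10) && (k != rFree)] st.1 st'.1,
        st'.1 rFree = st.1 rFree + n, st'.1 rRow = st.1 rFree,
        forall i, i < n -> st'.2 (st.1 rFree + i) = g i &
        forall x, ~~ (st.1 rFree <= x < st.1 rFree + n) -> st'.2 x = st.2 x]).
Proof.
move=> HN HF Hb; set F := st.1 rFree in HF Hb *.
pose Inv i (st' : state) := [/\ frame (fun k => k < 10) st.1 st'.1, st'.1 rI = i,
  forall k, k < i -> st'.2 (F + k) = g k &
  forall x, ~~ (F <= x < F + i) -> st'.2 x = st.2 x].
rewrite addnS; apply: tri_asg_seq => //.
rewrite (_ : _ + 3 = (\sum_(i < n) (T i + 2).+1).+1 + 2); last first.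
  by rewrite addSnnS; congr (_ + _); apply: eq_bigr => i _; rewrite addnS.
apply: tri_seq; apply: tri_weaken (@tri_for L Inv _ _ n (fun i => T i + 2) _ _ _ _) (leqnn _) _.
- move=> j st' Hj [E1 E2 _ _]; rewrite /= E2 E1 // HN; apply/eqP; lia.
- move=> i st' Hi [E1 E2 E3 E4].
  apply: tri_seq; apply: tri_weaken (Hb i st' Hi E1 E2 _) (leqnn _) _.
    by move=> x Hx; apply: E4; lia.
  move=> st2 [H1 H2 H3].
  have EF : st2.1 rFree = F by rewrite H2 // E1.
  have EI : st2.1 rI = i by rewrite H2.
  apply: tri_store_seq => //.
    by rewrite /= EF EI /cell_free; lia.
  apply: tri_asg => //; split.
  + by move=> k Hk /=; rewrite upd_neq ?H2 ?E1 //; lia.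
  + by rewrite /upd /= EI addn1.
  + move=> k Hk /=; rewrite EF EI H3 H1 /upd eqn_add2l.
    by case: (eqVneq k i) => [-> //|Hki]; apply: E3; lia.
  move=> x Hx /=; rewrite EF EI H1 upd_neq; last lia.
  by apply: E4; lia.
- by split=> // k Hk /=; rewrite upd_neq //; lia.
move=> st1 [H1 H2 H3 H4].
have EF : st1.1 rFree = F by rewrite H1.
apply: tri_asg_seq => //; apply: tri_asg => //; split=> //.
- by move=> k /= /andP [Hk Hk']; rewrite upd_neq // upd_neq ?H1 //; lia.
by rewrite /upd /= EF H1 // HN.
Qed.

(** * Evaluation of a single formula node *)

(** Tables are described in the initial memory [im]; taking for [bound] the start of the formula
    places them where the main loop never writes. *)
Definition table (im : memory) (bound base : nat) (rows : seq (seq nat)) : Prop :=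
  [/\ 10 <= base, base + size rows <= bound & forall i, i < size rows ->
    [/\ 10 <= im (base + i), im (base + i) + size (nth [::] rows i) <= bound &
        forall j, j < size (nth [::] rows i) ->
          im (im (base + i) + j) = nth 0 (nth [::] rows i) j]].

Section Nodes.
Variables (L n aP aR aV aF : nat) (im : memory).
Variables (cls prf : nat -> nat -> bool) (adj : nat -> seq nat) (vals : seq (nat -> bool)).

Definition bits (f : nat -> bool) : seq nat := [seq nat_of_bool (f j) | j <- iota 0 n].

Hypothesis aF_le : aF <= L.
Hypothesis cls_table : table im aF addrA [seq bits (cls i) | i <- iota 0 n].
Hypothesis prf_table : table im aF aP [seq bits (prf i) | i <- iota 0 n].
Hypothesis adj_table : table im aF aR [seq size (adj i) :: adj i | i <- iota 0 n].
Hypothesis val_table : table im aF aV [seq bits f | f <- vals].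
Hypothesis adj_bound : forall i, i < n -> all (fun j => j < n) (adj i).

Definition loop_inv (st : state) : Prop :=
  [/\ [/\ st.1 rN = n, st.1 rPref = aP, st.1 rAcc = aR, st.1 rVal = aV & st.1 rRoot = aF],
      L + 40 <= st.1 rFree,
      forall x, 10 <= x < aF -> st.2 x = im x &
      forall x, st.1 rFree <= x -> st.2 x = 0].

(** Either zone, the input tables or the allocated heap below [rFree], is left alone by later
    iterations, so a row once obtained persists. *)
Definition is_row (st : state) (q : nat) (f : nat -> bool) : Prop :=
  ((10 <= q) && (q + n <= aF) || (L + 40 <= q) && (q + n <= st.1 rFree)) /\
  forall i, i < n -> st.2 (q + i) = f i.

Lemma matrix_cell (rel : nat -> nat -> bool) base : 
  table im aF base [seq bits (rel i) | i <- iota 0 n] ->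
  10 <= base /\ forall h, (forall x, 10 <= x < aF -> h x = im x) ->
  forall u v, u < n -> v < n ->
  [/\ cell_free L (base + u), cell_free L (h (base + u) + v) &
      h (h (base + u) + v) = rel u v].
Proof.
case=> H1 H2 H3; rewrite size_map size_iota in H2 H3.
split=> // h Hh u v Hu Hv; have [] := H3 u Hu.
rewrite (nth_map 0) ?size_iota // nth_iota // size_map size_iota add0n => H4 H5 /(_ v Hv).
rewrite (nth_map 0) ?size_iota // nth_iota // add0n => H6.
have E : h (base + u) = im (base + u) by apply: Hh; lia.
rewrite E; split.
- by rewrite /cell_free; lia.
- by rewrite /cell_free; lia.
by rewrite Hh // ; lia.
Qed.

Lemma row_free st q f i : is_row st q f -> i < n -> cell_free L (q + i).
Proof. by case=> H _ Hi; rewrite /cell_free; lia. Qed.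

Definition row_post (f : nat -> bool) (st st' : state) : Prop :=
  [/\ loop_inv st', st'.1 rNode = st.1 rNode, is_row st' (st'.1 rRow) f,
      forall x, x < st.1 rFree -> st'.2 x = st.2 x & st.1 rFree <= st'.1 rFree].

Definition node_at (st : state) (tag a1 a2 : nat) : Prop :=
  let p := st.1 rNode in
  [/\ aF <= p, p + 3 <= L, st.1 rTag = tag, st.2 (p + 1) = a1 & st.2 (p + 2) = a2].

Lemma node_free (st : state) tag a1 a2 : node_at st tag a1 a2 ->
  [/\ cell_free L (st.1 rNode), cell_free L (st.1 rNode + 1) & cell_free L (st.1 rNode + 2)].
Proof.
by case=> H1 H2 _ _ _; case: cls_table; rewrite /addrA /cell_free => *; split; lia.
Qed.

Lemma tag_isP k c1 c2 (st : state) T Q :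
  tri L (if st.1 rTag == k then c1 else c2) st T Q -> tri L (tag_is k c1 c2) st T.+1 Q.
Proof.
move=> H; apply: tri_if => //=.
have -> : (st.1 7 - k + (k - st.1 7) == 0) = (st.1 7 == k) by lia.
by [].
Qed.

Lemma map_row body (g : nat -> bool) T (st : state) :
  loop_inv st ->
  (forall i (st' : state), i < n -> frame (fun k => k < 10) st.1 st'.1 -> st'.1 rI = i ->
     (forall x, x < st.1 rFree -> st'.2 x = st.2 x) ->
     tri L body st' (T i) (fun st2 : state =>
       [/\ st2.2 = st'.2, frame (fun k => k < 11) st'.1 st2.1 & st2.1 rOut = g i])) ->
  tri L (map_loop body) st (\sum_(i < n) (T i + 3) + 4) (fun st' : state => row_post g st st' /\
    frame [pred k | (k < 10) && (k != rFree)] st.1 st'.1).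
Proof.
move=> [[E1 E2 E3 E4 E5] HF Him Hz] Hb.
apply: tri_weaken (map_loopP E1 HF Hb) (leqnn _) _ => st' [H1 H2 H3 H4 H5].
split=> //; split.
- split; [by rewrite !H1|by rewrite H2; lia| |].
    by move=> x Hx; rewrite H5 ?Him //; lia.
  by move=> x; rewrite H2 => Hx; rewrite H5 ?Hz //; lia.
- by rewrite H1.
- by rewrite H3; split=> [|i Hi]; [lia|rewrite H4].
- by move=> x Hx; apply: H5; lia.
by rewrite H2; lia.
Qed.

Lemma neg_nodeP f (st : state) : loop_inv st -> is_row st (st.1 rX) f ->
  tri L neg_node st (4 * n + 4) (row_post (fun i => ~~ f i) st).
Proof.
move=> Hi Hf; have [Hf1 Hf2] := Hf.
have HF : L + 40 <= st.1 rFree by case: Hi.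
apply: tri_weaken (map_row Hi (g := fun i => ~~ f i) (T := fun=> 1) _) _ _; last by move=> ? [].
  move=> i st' Hn H1 H2 H3.
  have E : st'.2 (st'.1 rX + st'.1 rI) = f i by rewrite H1 // H2 H3 ?Hf2 //; lia.
  apply: tri_asg; first by rewrite /= H1 // H2 (row_free Hf).
  split=> //; first by move=> k Hk /=; rewrite upd_neq //; lia.
  by rewrite /upd /= E; case: (f i).
by rewrite sum_nat_const card_ord; lia.
Qed.

Definition bool_op (tag : nat) (x y : bool) : bool :=
  match tag with
  | 2 | 10 => x && y
  | 3 | 11 => x || y
  | 4 | 12 => x ==> y
  | _ => x == y
  end.

Lemma bool_nodeP f g (st : state) tag :
  loop_inv st -> is_row st (st.1 rX) f -> is_row st (st.1 rY) g -> st.1 rTag = tag ->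
  tag \in [:: 2; 3; 4; 5; 10; 11; 12; 13] ->
  tri L bool_node st (10 * n + 4) (row_post (fun i => bool_op tag (f i) (g i)) st).
Proof.
move=> Hi Hf Hg Ht Htag; have [Hf1 Hf2] := Hf; have [Hg1 Hg2] := Hg.
have HF : L + 40 <= st.1 rFree by case: Hi.
(* The 7 units are six tag tests and one assignment. *)
apply: tri_weaken (map_row Hi (g := fun i => bool_op tag (f i) (g i)) (T := fun=> 7) _) _ _;
  last by move=> ? [].
  move=> i st' Hn H1 H2 H3.
  have E1 : st'.2 (st'.1 rX + st'.1 rI) = f i by rewrite H1 // H2 H3 ?Hf2 //; lia.
  have E2 : st'.2 (st'.1 rY + st'.1 rI) = g i by rewrite H1 // H2 H3 ?Hg2 //; lia.
  have S1 : cell_free L (st'.1 rX + st'.1 rI) by rewrite H1 // H2 (row_free Hf).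
  have S2 : cell_free L (st'.1 rY + st'.1 rI) by rewrite H1 // H2 (row_free Hg).
  have assign r e T : safe L st' e -> ev L st' e = r ->
      tri L (rOut ::= e) st' T.+1 (fun st2 : state =>
       [/\ st2.2 = st'.2, frame (fun k => k < 11) st'.1 st2.1 & st2.1 rOut = r]).
    move=> Hs He; apply: tri_asg => //; split=> // k Hk /=.
    by rewrite upd_neq //; lia.
  have Ht' : st'.1 rTag = tag by rewrite H1.
  move: tag Ht' Htag {Ht}; do 14 (case; first (move=> Ht' //= _;
    (do ? (apply: tag_isP; rewrite Ht' [_ == _]/=));
    (apply: assign; first by rewrite /= S1 S2);
    by rewrite /= E1 E2; case: (f i); case: (g i))).
  by move=> tag _; rewrite !inE.
by rewrite sum_nat_const card_ord; lia.
Qed.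

Lemma bel_nodeP f (st : state) : loop_inv st -> is_row st (st.1 rX) f ->
  tri L bel_node st (\sum_(i < n) (3 * size (adj i) + 7) + 4)
    (row_post (fun i => all f (adj i)) st).
Proof.
move=> Hi Hf; have [Hf1 Hf2] := Hf.
have [[EN EP ER EV ET] HF Him Hz] := Hi.
apply: tri_weaken (map_row Hi (g := fun i => all f (adj i))
  (T := fun i => (3 * size (adj i) + 3).+1) _) _ _; last by move=> ? [].
  move=> i st' Hn H1 H2 H3.
  have [B1 B2 B3] := adj_table; rewrite size_map size_iota in B2 B3.
  have [] := B3 i Hn; rewrite (nth_map 0) ?size_iota // nth_iota // add0n => C1 C2 C3.
  rewrite [size _]/= in C2 C3.
  have EL : st'.2 (st'.1 rAcc + st'.1 rI) = im (aR + i).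
    by rewrite H1 // ER H2 H3 ?Him //; lia.
  set q := im (aR + i) in C1 C2 C3 EL.
  have Hq j : j <= size (adj i) -> st'.2 (q + j) = nth 0 (size (adj i) :: adj i) j.
    by move=> Hj; rewrite H3 ?Him ?C3 //; lia.
  apply: tri_asg_seq; first by rewrite /= H1 // ER H2 /cell_free; lia.
  rewrite [ev _ _ _]/= EL.
  apply: tri_weaken (all_loopP (m := size (adj i)) (f := fun j => f (nth 0 (adj i) j)) _ _)
    (leqnn _) _.
  - move=> st2 /= D1 D2; have E : st2.1 rList = q by rewrite D2.
    rewrite E D1 -[q]addn0 Hq //; split=> //; rewrite /cell_free; lia.
  - move=> st2 /= D1 D2 D3; have E : st2.1 rList = q by rewrite D2.
    have EX : st2.1 rX = st.1 rX by rewrite D2 //= upd_neq // H1.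
    have A1 : st2.2 (st2.1 rList + 1 + st2.1 rJ) = nth 0 (adj i) (st2.1 rJ).
      by rewrite E D1 -addnA add1n Hq.
    have A2 : nth 0 (adj i) (st2.1 rJ) < n.
      by have /all_nthP -> := adj_bound Hn.
    rewrite A1 EX (row_free Hf) // andbT D1 H3 ?Hf2 //; last lia.
    by split=> //; rewrite E /cell_free; lia.
  move=> st2 /= [D1 D2 D3]; split=> //.
    by move=> k Hk; rewrite D2 /= ?upd_neq //; lia.
  rewrite D3; congr nat_of_bool.
  by rewrite -[in RHS](mkseq_nth 0 (adj i)) /mkseq all_map.
by rewrite leq_add2r leq_sum // => i _; lia.
Qed.

(** Evaluated directly, the nested quantifiers over [u] and [v] would cost n^3 for all [i]. Whether
    [u] is bad does not depend on [i], so tabulating the bad states first leaves two quadratic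
    passes. *)
Lemma sup_nodeP f g (st : state) : loop_inv st -> is_row st (st.1 rX) f -> is_row st (st.1 rY) g ->
  tri L sup_node st (6 * n ^ 2 + 13 * n + 9)
    (row_post (fun i => all (fun u => cls i u ==> ~~ [&& f u, ~~ g u &
       all (fun v => f v && prf v u ==> prf u v) (iota 0 n)]) (iota 0 n)) st).
Proof.
move=> Hi Hf Hg; have [Hf1 Hf2] := Hf; have [Hg1 Hg2] := Hg.
have [[EN EP ER EV ET] HF Him Hz] := Hi.
have [A10 cellA] := matrix_cell cls_table; have [P10 cellP] := matrix_cell prf_table.
have -> : 6 * n ^ 2 + 13 * n + 9 = (n * (3 * n + 7) + 4) + (n * (3 * n + 6) + 4).+1 by lia.
pose bad u := [&& f u, ~~ g u & all (fun v => f v && prf v u ==> prf u v) (iota 0 n)].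
apply: tri_seq.
apply: tri_weaken (map_row (g := bad) Hi (T := fun i => 3 * n + 3 + 1) _) _ _.
- move=> i st' Hn H1 H2 H3.
  have him x : 10 <= x < aF -> st'.2 x = im x by move=> Hx; rewrite H3 ?Him //; lia.
  apply: tri_seq; apply: tri_weaken
    (all_loopP (m := n) (f := fun v => f v && prf v i ==> prf i v) _ _) (leqnn _) _.
  + by move=> st2 D1 D2 /=; split=> //; rewrite D2 // H1.
  + move=> st2 D1 D2 D3.
    have EI : st2.1 rI = i by rewrite D2.
    have EX : st2.1 rX = st.1 rX by rewrite D2 // H1.
    have EPr : st2.1 rPref = aP by rewrite D2 // H1.
    have [S1 S2 S3] := cellP _ him _ _ D3 Hn; have [S4 S5 S6] := cellP _ him _ _ Hn D3.
    rewrite /= EX EPr EI D1 S1 S2 S3 S4 S5 S6 (row_free Hf) //; split=> //.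
    rewrite H3 ?Hf2 //; last lia.
    by case: (f _); case: (prf _ i); case: prf.
  move=> st2 [D1 D2 D3].
  have EI : st2.1 rI = i by rewrite D2.
  have EX : st2.1 rX = st.1 rX by rewrite D2 // H1.
  have EY : st2.1 rY = st.1 rY by rewrite D2 // H1.
  apply: tri_asg; first by rewrite /= EX EY EI (row_free Hf) // (row_free Hg).
  split=> //; first by move=> k Hk /=; rewrite upd_neq ?D2 //=; lia.
  rewrite /upd /= EX EY EI D1 D3 !H3 ?Hf2 ?Hg2 //; try lia.
  by rewrite /bad; case: (f i); case: (g i); case: all.
- by rewrite sum_nat_const card_ord; lia.
move=> st1 [[I1 E1 R1 F1 G1] F2].
apply: tri_asg_seq => //; set st2 := (_, _).
have I2 : loop_inv st2 by [].
have R2 : is_row st2 (st2.1 rY) bad by [].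
have [R3 R4] := R2.
have [[_ _ _ _ _] HF2 Him2 _] := I2.
pose res i := all (fun u => cls i u ==> ~~ bad u) (iota 0 n).
apply: tri_weaken (map_row (g := res) I2 (T := fun i => 3 * n + 3) _) _ _.
- move=> i st' Hn H1 H2 H3.
  have him x : 10 <= x < aF -> st'.2 x = im x by move=> Hx; rewrite H3 ?Him2 //; lia.
  apply: tri_weaken (all_loopP (m := n) (f := fun u => cls i u ==> ~~ bad u) _ _) (leqnn _) _.
  + move=> st3 D1 D2 /=; split=> //; rewrite D2 // H1 //; by case: I2 => [[]].
  + move=> st3 D1 D2 D3.
    have EI : st3.1 rI = i by rewrite D2.
    have EY : st3.1 rY = st2.1 rY by rewrite D2 // H1.
    have [S4 S5 S6] := cellA _ him _ _ Hn D3.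
    rewrite [safe _ _ _]/= [ev _ _ _]/= EY EI D1 S4 S5 S6 (row_free R2) //; split=> //.
    rewrite H3 ?R4 //; last lia.
    by case: (cls _ _); case: (bad _).
  move=> st3 [D1 D2 D3]; split=> //.
  by move=> k Hk; rewrite D2 //=; lia.
- by rewrite sum_nat_const card_ord; lia.
move=> st3 [[I3 E3 R5 F3 G3] _]; split=> //.
- by rewrite E3 /= upd_neq.
- by move=> x Hx; rewrite F3 /= ?F1 //; exact: leq_trans G1.
exact: leq_trans G1 G3.
Qed.

Definition child (st : state) (a : nat) (f : nat -> bool) : Prop :=
  aF <= a < L /\ is_row st (st.2 a) f.

Lemma table_aF : 10 <= aF.
Proof. by case: cls_table; rewrite /addrA; lia. Qed.

Lemma child_free st a f : child st a f -> cell_free L a.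
Proof. by case=> H _; have := table_aF; rewrite /cell_free; lia. Qed.

(** The remaining command [c] is kept abstract because the tag tests continue after the load. *)
Lemma load_x (st : state) tag a1 a2 f c T Q :
  loop_inv st -> node_at st tag a1 a2 -> child st a1 f ->
  (forall st1 : state, loop_inv st1 -> node_at st1 tag a1 a2 -> st1.2 = st.2 ->
     st1.1 rNode = st.1 rNode -> st1.1 rFree = st.1 rFree ->
     is_row st1 (st1.1 rX) f -> tri L c st1 T Q) ->
  tri L (rX ::= ELoad (ELoad ($rNode + 1));; c) st T.+1 Q.
Proof.
move=> Hi Hn Hc H; have [_ S1 _] := node_free Hn.
have E1 : st.2 (st.1 rNode + 1) = a1 by case: Hn.
apply: tri_asg_seq; first by rewrite /= S1 E1 (child_free Hc).
rewrite [ev _ _ _]/= E1; apply: H => //.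
by rewrite /= /upd /=; case: Hc.
Qed.

Lemma load_y (st : state) tag a1 a2 f g c T Q :
  loop_inv st -> node_at st tag a1 a2 -> child st a2 g -> is_row st (st.1 rX) f ->
  (forall st1 : state, loop_inv st1 -> node_at st1 tag a1 a2 -> st1.2 = st.2 ->
     st1.1 rNode = st.1 rNode -> st1.1 rFree = st.1 rFree ->
     is_row st1 (st1.1 rX) f -> is_row st1 (st1.1 rY) g -> tri L c st1 T Q) ->
  tri L (rY ::= ELoad (ELoad ($rNode + 2));; c) st T.+1 Q.
Proof.
move=> Hi Hn Hc Hf H; have [_ _ S1] := node_free Hn.
have E1 : st.2 (st.1 rNode + 2) = a2 by case: Hn.
apply: tri_asg_seq; first by rewrite /= S1 E1 (child_free Hc).
rewrite [ev _ _ _]/= E1; apply: H => //.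
by rewrite /= /upd /=; case: Hc.
Qed.

Lemma row_post_shift f (st st1 st2 : state) : row_post f st1 st2 ->
  st1.2 = st.2 -> st1.1 rNode = st.1 rNode -> st1.1 rFree = st.1 rFree -> row_post f st st2.
Proof. by case=> H1 H2 H3 H4 H5 E1 E2 E3; split; rewrite -?E1 -?E2 -?E3. Qed.

Lemma node_tag (st : state) tag a1 a2 : node_at st tag a1 a2 -> st.1 rTag = tag.
Proof. by case. Qed.

Lemma bot_row (st : state) a1 a2 : loop_inv st -> node_at st 0 a1 a2 ->
  tri L node_row st 16 (row_post xpred0 st).
Proof.
move=> Hi Hn; have [[E1 E2 E3 E4 E5] HF Him Hz] := Hi.
apply: tag_isP; rewrite (node_tag Hn) [_ == _]/=.
apply: tri_asg_seq => //; apply: tri_asg => //; rewrite /= /upd /= E1.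
split=> //=.
- by split=> //=; [lia|move=> x Hx; apply: Hz; lia].
- by split=> //= [|i Hi']; [lia|rewrite Hz //; lia].
lia.
Qed.

Lemma var_row (st : state) p a2 : loop_inv st -> node_at st 1 p a2 -> p < size vals ->
  tri L node_row st 16 (row_post (nth xpred0 vals p) st).
Proof.
move=> Hi Hn Hp; have [[E1 E2 E3 E4 E5] HF Him Hz] := Hi.
do 2 (apply: tag_isP; rewrite (node_tag Hn) [_ == _]/=).
have [_ S1 _] := node_free Hn.
have EA : st.2 (st.1 rNode + 1) = p by case: Hn.
have [V1 V2 V3] := val_table; rewrite size_map in V2 V3.
have [] := V3 p Hp; rewrite (nth_map xpred0) // size_map size_iota => V4 V5 V6.
have EV : st.2 (aV + p) = im (aV + p) by apply: Him; lia.
apply: tri_asg; first by rewrite /= S1 EA E4 /cell_free; lia.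
rewrite /= EA E4 EV; split=> //; split=> /=; rewrite /upd /=; first lia.
move=> i Hin; rewrite Him; last lia.
by rewrite V6 // (nth_map 0) ?size_iota // nth_iota.
Qed.

Lemma prop_row (st : state) a1 a2 f : loop_inv st -> node_at st 7 a1 a2 -> child st a1 f ->
  tri L node_row st 16 (row_post f st).
Proof.
move=> Hi Hn Hc; do 2 (apply: tag_isP; rewrite (node_tag Hn) [_ == _]/=).
apply: load_x Hi Hn Hc _ => st1 I1 N1 M1 E1 E2 R1.
apply: tag_isP; rewrite (node_tag N1) [_ == _]/=.
by apply: tri_asg => //; apply: (@row_post_shift _ _ st1).
Qed.

Lemma neg_row (st : state) tag a1 a2 f : loop_inv st -> node_at st tag a1 a2 -> child st a1 f ->
  (tag == 6) || (tag == 14) ->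
  tri L node_row st (4 * n + 10) (row_post (fun i => ~~ f i) st).
Proof.
move=> Hi Hn Hc Ht.
rewrite (_ : 4 * n + 10 = (4 * n + 4).+4.+2); last lia.
apply: tag_isP; rewrite (node_tag Hn) (_ : tag == 0 = false); last lia.
apply: tag_isP; rewrite (node_tag Hn) (_ : tag == 1 = false); last lia.
apply: load_x Hi Hn Hc _ => st1 I1 N1 M1 E1 E2 R1.
apply: tag_isP; rewrite (node_tag N1) (_ : tag == 7 = false); last lia.
have H : tri L neg_node st1 (4 * n + 4) (row_post (fun i => ~~ f i) st).
  apply: tri_weaken (neg_nodeP I1 R1) (leqnn _) _ => st2 H.
  exact: row_post_shift H _ _ _.
apply: tag_isP; rewrite (node_tag N1); case: eqP => [_|H6].
  exact: tri_weaken H (leqW (leqnn _)) _.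
by apply: tag_isP; rewrite (node_tag N1) (_ : tag == 14 = true); last lia.
Qed.

Lemma bel_row (st : state) a1 a2 f : loop_inv st -> node_at st 9 a1 a2 -> child st a1 f ->
  tri L node_row st (\sum_(i < n) (3 * size (adj i) + 7) + 11)
    (row_post (fun i => all f (adj i)) st).
Proof.
move=> Hi Hn Hc.
rewrite (_ : _ + 11 = (\sum_(i < n) (3 * size (adj i) + 7) + 4).+4.+3); last lia.
do 2 (apply: tag_isP; rewrite (node_tag Hn) [_ == _]/=).
apply: load_x Hi Hn Hc _ => st1 I1 N1 M1 E1 E2 R1.
do 4 (apply: tag_isP; rewrite (node_tag N1) [_ == _]/=).
apply: tri_weaken (bel_nodeP I1 R1) (leqnn _) _ => st2 H.
exact: row_post_shift H _ _ _.
Qed.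

Lemma sup_row (st : state) a1 a2 f g : loop_inv st -> node_at st 8 a1 a2 ->
  child st a1 f -> child st a2 g ->
  tri L node_row st (6 * n ^ 2 + 13 * n + 18)
    (row_post (fun i => all (fun u => cls i u ==> ~~ [&& f u, ~~ g u &
       all (fun v => f v && prf v u ==> prf u v) (iota 0 n)]) (iota 0 n)) st).
Proof.
move=> Hi Hn Hc Hd.
rewrite (_ : _ + 18 = (6 * n ^ 2 + 13 * n + 9).+4.+4.+1); last lia.
do 2 (apply: tag_isP; rewrite (node_tag Hn) [_ == _]/=).
apply: load_x Hi Hn Hc _ => st1 I1 N1 M1 E1 E2 R1.
do 4 (apply: tag_isP; rewrite (node_tag N1) [_ == _]/=).
have Hd1 : child st1 a2 g.
  by case: Hd => Hd1 Hd2; split=> //; rewrite /is_row M1 E2.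
apply: load_y I1 N1 Hd1 R1 _ => st2 I2 N2 M2 E3 E4 R2 R3.
apply: tag_isP; rewrite (node_tag N2) [_ == _]/=.
apply: tri_weaken (sup_nodeP I2 R2 R3) (leqnn _) _ => st3 H.
by apply: row_post_shift H _ _ _; rewrite ?M2 ?E3 ?E4.
Qed.

Lemma bool_row (st : state) tag a1 a2 f g : loop_inv st -> node_at st tag a1 a2 ->
  child st a1 f -> child st a2 g -> tag \in [:: 2; 3; 4; 5; 10; 11; 12; 13] ->
  tri L node_row st (10 * n + 13) (row_post (fun i => bool_op tag (f i) (g i)) st).
Proof.
move=> Hi Hn Hc Hd Ht.
have neq k : k \in [:: 0; 1; 6; 7; 8; 9; 14] -> (tag == k) = false.
  by apply: contraTF => /eqP E; move: Ht; rewrite E !inE; lia.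
rewrite (_ : _ + 13 = (10 * n + 4).+4.+4.+1); last lia.
do 2 (apply: tag_isP; rewrite (node_tag Hn) neq //).
apply: load_x Hi Hn Hc _ => st1 I1 N1 M1 E1 E2 R1.
do 4 (apply: tag_isP; rewrite (node_tag N1) neq //).
have Hd1 : child st1 a2 g.
  by case: Hd => Hd1 Hd2; split=> //; rewrite /is_row M1 E2.
apply: load_y I1 N1 Hd1 R1 _ => st2 I2 N2 M2 E3 E4 R2 R3.
apply: tag_isP; rewrite (node_tag N2) neq //.
apply: tri_weaken (bool_nodeP I2 R2 R3 (node_tag N2) Ht) (leqnn _) _ => st3 H.
by apply: row_post_shift H _ _ _; rewrite ?M2 ?E3 ?E4.
Qed.

(** * Evaluation of a whole subformula *)

(** Inside the segment only the root pointer is described, which is all that a parent node reads. *)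
Definition seg_post (b sz : nat) (f : nat -> bool) (st st' : state) : Prop :=
  [/\ loop_inv st', st'.1 rNode = b, is_row st' (st'.2 b) f,
      forall x, x < st.1 rFree -> ~~ (b <= x < b + 3 * sz) -> st'.2 x = st.2 x &
      st.1 rFree <= st'.1 rFree].

(** The 4 extra units are the loop test, the two assignments of [node_body] and its final store. *)
Lemma node_step (st : state) b tag a1 a2 f T T' Q :
  loop_inv st -> st.1 rNode = b + 3 -> aF <= b -> b + 3 <= L ->
  st.2 b = tag -> st.2 (b + 1) = a1 -> st.2 (b + 2) = a2 ->
  (forall st1 : state, loop_inv st1 -> st1.2 = st.2 -> st1.1 rFree = st.1 rFree ->
     node_at st1 tag a1 a2 -> tri L node_row st1 T (row_post f st1)) ->
  (forall st' : state, seg_post b 1 f st st' -> tri L main_loop st' T' Q) ->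
  tri L main_loop st (T + 4 + T') Q.
Proof.
move=> Hi HN Hb1 Hb2 H0 H1 H2 Hrow Hk; have A10 := table_aF.
have [[E1 E2 E3 E4 E5] HF Him Hz] := Hi.
rewrite (_ : T + 4 + T' = (T + 3 + T').+1); last lia.
apply: tri_while => //=; first by rewrite HN E5; lia.
rewrite addnS; apply: tri_asg_seq => //; rewrite [ev _ _ _]/= HN (_ : b + 3 - 3 = b); last lia.
rewrite addnS; apply: tri_asg_seq; first by rewrite /= /upd /= /cell_free; lia.
set st1 := (_, _).
have F1 : st1.1 rNode = b by [].
apply: tri_seq; apply: tri_weaken (Hrow st1 _ _ _ _) (leqnn _) _ => //.
move=> st2 [I2 N2 R2 M2 G2]; rewrite F1 in N2; rewrite [st1.1 _]/= in M2 G2.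
have G2' : st.1 rFree <= st2.1 rFree by [].
have M2' x : x < st.1 rFree -> st2.2 x = st.2 x by apply: M2.
apply: tri_store => //; first by rewrite /= N2 /cell_free; lia.
rewrite /= N2; apply: Hk; split=> //=.
- case: I2 => I21 I22 I23 I24; split=> //= x Hx; first by rewrite upd_neq ?I23 //; lia.
  by rewrite upd_neq ?I24 //; lia.
- rewrite upd_eq; case: R2 => R21 R22; split=> //= i Hin.
  rewrite upd_neq ?R22 //; lia.
by move=> x Hx Hxb; rewrite upd_neq ?M2' //; lia.
Qed.

(* Running the main loop over the part of the formula stored at [b] replaces the
   tag of its root by a pointer to the truth row [f]; stated in
   continuation-passing form to compose iterations of one loop. *)
Definition processes (b sz : nat) (code : seq nat) (f : nat -> bool) (T : nat) : Prop :=
  size code = 3 * sz /\ forall (st : state) T' Q,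
  aF <= b -> b + 3 * sz <= L -> loop_inv st -> st.1 rNode = b + 3 * sz ->
  (forall i, i < 3 * sz -> st.2 (b + i) = nth 0 code i) ->
  (forall st' : state, seg_post b sz f st st' -> tri L main_loop st' T' Q) ->
  tri L main_loop st (T + T') Q.

Lemma leaf_proc b tag a1 a2 f T :
  (forall st, loop_inv st -> node_at st tag a1 a2 -> tri L node_row st T (row_post f st)) ->
  processes b 1 [:: tag; a1; a2] f (T + 4).
Proof.
move=> H; split=> // st T' Q Hb1 Hb2 Hi HN Hc Hk.
apply: (node_step (tag := tag) (a1 := a1) (a2 := a2) Hi HN) (Hk) => //.
- by have := Hc 0 isT; rewrite addn0.
- exact: (Hc 1).
- exact: (Hc 2).
by move=> st1 I1 _ _; apply: H.
Qed.

Lemma child_of_seg b sz f (st st' : state) : seg_post b sz f st st' ->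
  aF <= b < L -> child st' b f.
Proof. by case=> _ _ H _ _. Qed.

Lemma child_frame b sz g a f (st st' : state) : seg_post b sz g st st' -> loop_inv st ->
  b + 3 * sz <= L -> aF <= b -> child st a f -> ~~ (b <= a < b + 3 * sz) -> child st' a f.
Proof.
move=> [_ _ _ M G] [_ HF _ _] Hb1 Hb2 [Ha [R1 R2]] Hn.
split=> //; rewrite M //; last lia.
split=> [|i Hi]; first lia.
by rewrite M ?R2 //; lia.
Qed.

Lemma seg_post_trans b1 sz1 f b2 sz2 g sz (st st1 st2 : state) :
  seg_post b1 sz1 f st st1 -> seg_post b2 sz2 g st1 st2 ->
  b2 <= b1 -> b1 + 3 * sz1 <= b2 + 3 * sz -> sz2 <= sz -> seg_post b2 sz g st st2.
Proof.
move=> [_ _ _ M1 G1] [I2 N2 R2 M2 G2] H1 H2 H3; split=> //; last exact: leq_trans G1 G2.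
move=> x Hx Hn; rewrite M2; [apply: M1 => //|exact: leq_trans G1|]; lia.
Qed.

Lemma un_proc b sz code tag f g T1 T :
  (forall st, loop_inv st -> node_at st tag (b + 3) 0 -> child st (b + 3) f ->
     tri L node_row st T (row_post g st)) ->
  0 < sz -> processes (b + 3) sz code f T1 ->
  processes b sz.+1 ([:: tag; b + 3; 0] ++ code) g (T1 + T + 4).
Proof.
move=> H Hsz [Hs H1]; split; first by rewrite /= Hs; lia.
move=> st T' Q Hb1 Hb2 Hi HN Hc Hk; have [_ HF _ _] := Hi.
rewrite (_ : _ + T' = T1 + (T + 4 + T')); last lia.
apply: H1 => //; try lia.
  by move=> i Hi'; rewrite -addnA Hc //; lia.
move=> st1 P1; have [I1 N1 R1 M1 G1] := P1.
have C1 : child st1 (b + 3) f by apply: child_of_seg P1 _; lia.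
have Hc' i : i < 3 -> st1.2 (b + i) = nth 0 [:: tag; b + 3; 0] i.
  by move=> Hi3; rewrite M1 ?Hc ?nth_cat ?Hi3 //; lia.
apply: (node_step (tag := tag) (a1 := b + 3) (a2 := 0) (f := g) I1 N1) => //.
- lia.
- by have := Hc' 0 isT; rewrite addn0.
- exact: (Hc' 1).
- exact: (Hc' 2).
- move=> st2 I2 E2 F2 N2; apply: H => //.
  by case: C1 => C11 C12; split=> //; rewrite /is_row E2 F2.
move=> st2 P2; apply: Hk; apply: seg_post_trans P1 P2 _ _ _; lia.
Qed.

Lemma bin_proc b sz1 sz2 (e1 e2 : nat -> seq nat) tag f1 f2 g T1 T2 T :
  (forall st, loop_inv st -> node_at st tag (b + 3) (b + 3 + 3 * sz1) ->
     child st (b + 3) f1 -> child st (b + 3 + 3 * sz1) f2 ->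
     tri L node_row st T (row_post g st)) ->
  0 < sz1 -> 0 < sz2 ->
  processes (b + 3) sz1 (e1 (b + 3)) f1 T1 ->
  processes (b + 3 + 3 * sz1) sz2 (e2 (b + 3 + 3 * sz1)) f2 T2 ->
  processes b (sz1 + sz2).+1 (enc_bin tag b sz1 e1 e2) g (T1 + T2 + T + 4).
Proof.
rewrite /enc_bin; set b2 := b + 3 + 3 * sz1.
move=> H Hsz1 Hsz2 [Hs1 H1] [Hs2 H2]; split; first by rewrite /= size_cat Hs1 Hs2; lia.
move=> st T' Q Hb1 Hb2 Hi HN Hc Hk; have [_ HF _ _] := Hi.
(* The scan runs downwards, so the right operand, stored last, is evaluated first. *)
rewrite (_ : _ + T' = T2 + (T1 + (T + 4 + T'))); last lia.
apply: H2 => //; try lia.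
  move=> i Hi'; rewrite (_ : b2 + i = b + (3 + (3 * sz1 + i))); last by rewrite /b2; lia.
  rewrite Hc; last lia.
  rewrite [LHS](_ : _ = nth 0 (e1 (b + 3) ++ e2 b2) (3 * sz1 + i)) //.
  by rewrite nth_cat Hs1 ltnNge leq_addr /= addKn.
move=> st1 P1; have [I1 N1 R1 M1 G1] := P1.
have C2 : child st1 b2 f2 by apply: child_of_seg P1 _; lia.
apply: H1 => //; try lia.
  move=> i Hi'; rewrite M1; try lia.
  rewrite -addnA Hc; last lia.
  rewrite [LHS](_ : _ = nth 0 (e1 (b + 3) ++ e2 b2) i) //.
  by rewrite nth_cat Hs1 Hi'.
move=> st2 P2; have [I2 N2 R2 M2 G2] := P2.
have C1 : child st2 (b + 3) f1 by apply: child_of_seg P2 _; lia.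
(* The row of the right operand must survive the evaluation of the left one. *)
have {}C2 : child st2 b2 f2 by apply: child_frame P2 I1 _ _ C2 _; lia.
have Hc' i : i < 3 -> st2.2 (b + i) = nth 0 [:: tag; b + 3; b2] i.
  by move=> Hi3; rewrite M2 ?M1 ?Hc ?nth_cat ?Hi3 //; lia.
apply: (node_step (tag := tag) (a1 := b + 3) (a2 := b2) (f := g) I2 N2) => //.
- lia.
- by have := Hc' 0 isT; rewrite addn0.
- exact: (Hc' 1).
- exact: (Hc' 2).
- move=> st3 I3 E3 F3 N3; apply: H => //.
    by case: C1 => C11 C12; split=> //; rewrite /is_row E3 F3.
  by case: C2 => C21 C22; split=> //; rewrite /is_row E3 F3.
move=> st3 P3; apply: Hk.
have P12 : seg_post (b + 3) (sz1 + sz2) f1 st st2 by apply: seg_post_trans P1 P2 _ _ _; lia.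
apply: seg_post_trans P12 P3 _ _ _; lia.
Qed.

End Nodes.

(** * Truth rows of formulas in a Trust model *)

Section Formulas.
Variables (S : finType) (I : eqType) (M : trust_model S I) (s0 : S).
Variables (L aP aR aV aF nv : nat) (im : memory).

Let n := #|S|.
Definition elt (i : nat) : S := nth s0 (enum S) i.
Definition clsN i j := part M (elt i) == part M (elt j).
Definition prfN i j := pref M (part M (elt i)) (elt i) (elt j).
Definition adjN i := [seq st_idx v | v <- enum S & acc M (elt i) v].
Definition valsN : seq (nat -> bool) := [seq (fun i => Defs.val M p (elt i)) | p <- iota 0 nv].

Lemma elt_idx (u : S) : elt (st_idx u) = u.
Proof. by rewrite /elt nth_index // mem_enum. Qed.

Lemma idx_lt (u : S) : st_idx u < n.
Proof. by rewrite /n cardE index_mem mem_enum. Qed.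

Lemma map_elt : map elt (iota 0 n) = enum S.
Proof. by rewrite /n cardE; apply: mkseq_nth. Qed.

Lemma all_elt (P : pred S) : all (fun i => P (elt i)) (iota 0 n) = [forall u, P u].
Proof.
rewrite -(all_map elt P) map_elt.
by apply/allP/forallP => [H u|H u _]; apply: H; rewrite ?mem_enum.
Qed.

Lemma all_adj (P : pred S) i :
  all (fun j => P (elt j)) (adjN i) = [forall v, acc M (elt i) v ==> P v].
Proof.
rewrite -(all_map elt P) -map_comp (eq_map elt_idx) map_id all_filter.
by apply/allP/forallP => [H u|H u _]; apply: H; rewrite ?mem_enum.
Qed.

Lemma adjN_bound i : i < n -> all (fun j => j < n) (adjN i).
Proof. by move=> _; apply/allP => j /mapP [v _ ->]; apply: idx_lt. Qed.

(** The shape computed by [sup_node]. The preference is indexed by the class of its first argument,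
    as in the rows of the matrix, and [v] may range over all of [S]: by [pref_dom] a state of
    another class falsifies the inner premise. *)
Lemma tsat_sup f g s : tsat M (TSup f g) s =
  [forall u, (part M s == part M u) ==> ~~ [&& psat (Defs.val M) f u, ~~ psat (Defs.val M) g u &
    [forall v, psat (Defs.val M) f v && pref M (part M v) v u ==> pref M (part M u) u v]]].
Proof.
apply: eq_forallb => u; rewrite /most /ext eq_sym.
case: eqP => //= Hu; case: (psat _ f u) => //=; rewrite negb_and negbK orbC -implybE.
congr (_ ==> _); apply: eq_forallb => v; rewrite Hu.
case: eqP => [->|Hv] /=; first by case: psat.
case: psat => //=; case E: pref => //; have /andP [_ /eqP E2] := pref_dom E.
by case: Hv; rewrite -E2.
Qed.

Hypothesis aF_le : aF <= L.
Hypothesis cls_table : table im aF addrA [seq bits n (clsN i) | i <- iota 0 n].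
Hypothesis prf_table : table im aF aP [seq bits n (prfN i) | i <- iota 0 n].
Hypothesis adj_table : table im aF aR [seq size (adjN i) :: adjN i | i <- iota 0 n].
Hypothesis val_table : table im aF aV [seq bits n f | f <- valsN].

Let proc := processes L n aP aR aV aF im.

Lemma processes_weaken b sz code f g T T' : proc b sz code f T ->
  (forall i, i < n -> f i = g i) -> T <= T' -> proc b sz code g T'.
Proof.
move=> [Hs H] Hfg HT; split=> // st T1 Q H1 H2 H3 H4 H5 H6.
apply: tri_weaken (H st T1 Q H1 H2 H3 H4 H5 _) _ _ => //; last by rewrite leq_add2r.
move=> st' [A1 A2 [A31 A32] A4 A5]; apply: H6; split=> //; split=> // i Hi.
by rewrite A32 ?Hfg.
Qed.

Lemma psz_gt0 f : 0 < psz f. Proof. by case: f. Qed.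
Lemma tsz_gt0 a : 0 < tsz a. Proof. by case: a. Qed.

Lemma bool_proc b tag sz1 sz2 e1 e2 f1 f2 T1 T2 :
  tag \in [:: 2; 3; 4; 5; 10; 11; 12; 13] -> 0 < sz1 -> 0 < sz2 ->
  proc (b + 3) sz1 (e1 (b + 3)) f1 T1 ->
  proc (b + 3 + 3 * sz1) sz2 (e2 (b + 3 + 3 * sz1)) f2 T2 ->
  proc b (sz1 + sz2).+1 (enc_bin tag b sz1 e1 e2) (fun i => bool_op tag (f1 i) (f2 i))
    (T1 + T2 + (10 * n + 13) + 4).
Proof.
move=> Ht S1 S2 P1 P2; apply: (bin_proc aF_le cls_table _ S1 S2 P1 P2).
by move=> st Hi Hn C1 C2; apply: (bool_row aF_le cls_table Hi Hn C1 C2 Ht).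
Qed.

Lemma neg_proc b tag sz code f T :
  (tag == 6) || (tag == 14) -> 0 < sz -> proc (b + 3) sz code f T ->
  proc b sz.+1 ([:: tag; b + 3; 0] ++ code) (fun i => ~~ f i) (T + (4 * n + 10) + 4).
Proof.
move=> Ht S1 P1; apply: (un_proc aF_le cls_table _ S1 P1).
by move=> st Hi Hn C1; apply: (neg_row aF_le cls_table Hi Hn C1 Ht).
Qed.

(** A leaf costs 20 = 16 + 4, and a binary connective absorbs the surplus 20 of one operand in its
    share 40 + 40 * n. Hence occurrences of variables are never counted. *)
Lemma proc_p f b : all (fun p => p < nv) (pvars f) ->
  proc b (psz f) (enc_p f b) (fun i => psat (Defs.val M) f (elt i))
    ((40 + 40 * n) * pconn f + 20).
Proof.
have arith T1 T2 c1 c2 : T1 = (40 + 40 * n) * c1 + 20 -> T2 = (40 + 40 * n) * c2 + 20 ->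
    T1 + T2 + (10 * n + 13) + 4 <= (40 + 40 * n) * (c1 + c2).+1 + 20.
  by move=> -> ->; lia.
elim: f b => [|p|f1 I1 f2 I2|f1 I1 f2 I2|f1 I1 f2 I2|f1 I1 f2 I2|f1 I1] b /=;
  rewrite ?all_cat.
- move=> _; apply: processes_weaken (leaf_proc aF_le cls_table b (f := xpred0) (T := 16) _) _ _.
  + by move=> st Hi Hn; apply: (bot_row aF_le Hi Hn).
  + by [].
  by rewrite muln0.
- rewrite andbT => Hp.
  apply: processes_weaken (leaf_proc aF_le cls_table b (f := nth xpred0 valsN p) (T := 16) _) _ _.
  + move=> st Hi Hn; apply: (var_row aF_le cls_table val_table Hi Hn).
    by rewrite size_map size_iota.
  + by move=> i _; rewrite (nth_map 0) ?size_iota // nth_iota.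
  by rewrite muln0.
1-4: move=> /andP [V1 V2]; apply: processes_weaken
    (bool_proc _ (psz_gt0 _) (psz_gt0 _) (I1 _ V1) (I2 _ V2)) _ _ => //; exact: arith.
move=> V1; apply: processes_weaken (neg_proc _ (psz_gt0 _) (I1 _ V1)) _ _ => //.
lia.
Qed.

Let r := \sum_(i < n) size (adjN i).

(** The additive 40 is the cost of an embedded leaf: 20 from [proc_p] and 16 + 4 for the [TProp]
    node. As before, binary nodes absorb one such surplus. *)
Lemma proc_t a b : all (fun p => p < nv) (tvars a) ->
  proc b (tsz a) (enc_t a b) (fun i => tsat M a (elt i))
    (100 * ((tconn a + nbel a) * (1 + n + r)) + 100 * (nsup a * (n ^ 2 + n + 1)) + 40).
Proof.
elim: a b => [f|f g|a1 I1|a1 I1 a2 I2|a1 I1 a2 I2|a1 I1 a2 I2|a1 I1 a2 I2|a1 I1] b /=;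
  rewrite ?all_cat.
- move=> V1; apply: processes_weaken
    (un_proc aF_le cls_table (T := 16) _ (psz_gt0 _) (proc_p _ V1)) _ _.
  + by move=> st Hi Hn C1; apply: (prop_row aF_le cls_table Hi Hn C1).
  + by [].
  by nia.
- move=> /andP [V1 V2].
  apply: processes_weaken (bin_proc aF_le cls_table _ (psz_gt0 _) (psz_gt0 _)
    (proc_p _ V1) (proc_p _ V2)) _ _.
  + by move=> st Hi Hn C1 C2; apply: (sup_row aF_le cls_table prf_table Hi Hn C1 C2).
  + move=> i Hi; rewrite -[RHS]/(tsat M (TSup f g) (elt i)) tsat_sup -all_elt.
    apply: eq_all => u; congr (_ ==> ~~ [&& _, _ & _]).
    exact: (all_elt (fun v => psat (Defs.val M) f v && pref M (part M v) v (elt u) ==>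
      pref M (part M (elt u)) (elt u) v)).
  by nia.
- move=> V1; apply: processes_weaken (un_proc aF_le cls_table _ (tsz_gt0 _) (I1 _ V1)) _ _.
  + by move=> st Hi Hn C1; apply: (bel_row aF_le cls_table adj_table adjN_bound Hi Hn C1).
  + by move=> i Hi; rewrite -all_adj.
  (* The sum over all states becomes 3 * r + 7 * n. *)
  rewrite big_split -big_distrr /= -/r sum_nat_const card_ord.
  by nia.
1-4: move=> /andP [V1 V2]; apply: processes_weaken
    (bool_proc _ (tsz_gt0 _) (tsz_gt0 _) (I1 _ V1) (I2 _ V2)) _ _ => //; nia.
move=> V1; apply: processes_weaken (neg_proc _ (tsz_gt0 _) (I1 _ V1)) _ _ => //.
nia.
Qed.

End Formulas.

(** * The encoded input and the run of the checker on it *)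

Lemma nth_flatten_row (rows : seq (seq nat)) i j :
  i < size rows -> j < size (nth [::] rows i) ->
  nth 0 (flatten rows) (sumn (map size (take i rows)) + j) = nth 0 (nth [::] rows i) j.
Proof.
elim: rows i => //= x rows IH [|i] /= Hi Hj; rewrite nth_cat ?add0n ?Hj //.
by rewrite -addnA ltnNge leq_addr /= addKn IH.
Qed.

Lemma row_end_le (rows : seq (seq nat)) i : i < size rows ->
  sumn (map size (take i rows)) + size (nth [::] rows i) <= size (flatten rows).
Proof.
elim: rows i => //= x rows IH [|i] /= Hi; rewrite size_cat; first lia.
by rewrite -addnA leq_add2l IH.
Qed.

Lemma size_encode_rows start rows :
  size (encode_rows start rows) = size rows + size (flatten rows).
Proof. by rewrite /encode_rows size_cat /ptrs size_map size_iota. Qed.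

Lemma table_encode_rows pre rows post bound base : size pre = base -> 10 <= base ->
  base + size (encode_rows base rows) <= bound ->
  table (nth 0 (pre ++ encode_rows base rows ++ post)) bound base rows.
Proof.
move=> Hb H10; rewrite size_encode_rows => Hbound; split=> //; first lia.
move=> i Hi.
have at_base j : nth 0 (pre ++ encode_rows base rows ++ post) (base + j) =
    nth 0 (encode_rows base rows ++ post) j.
  by rewrite nth_cat Hb ltnNge leq_addr /= addKn.
have Eptr : nth 0 (pre ++ encode_rows base rows ++ post) (base + i) =
    base + size rows + sumn (map size (take i rows)).
  rewrite at_base nth_cat size_encode_rows (_ : i < _); last lia.
  rewrite /encode_rows nth_cat /ptrs size_map size_iota Hi.
  by rewrite (nth_map 0) ?size_iota // nth_iota.
have He := row_end_le Hi; rewrite Eptr; split=> [||j Hj]; try lia.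
rewrite -!addnA at_base nth_cat size_encode_rows (_ : _ < _); last lia.
rewrite /encode_rows nth_cat /ptrs size_map size_iota ltnNge leq_addr /= addKn.
exact: nth_flatten_row.
Qed.

Lemma all_tvars_nvars a : all (fun p => p < nvars a) (tvars a).
Proof.
rewrite /nvars; elim: (tvars a) => //= p s IH; rewrite leq_maxl /=.
by apply: sub_all IH => q Hq; rewrite leq_max Hq orbT.
Qed.

Section Input.
Variables (S : finType) (I : eqType) (M : trust_model S I) (s : S) (a : tform).

Lemma map_enum (T : Type) (F : S -> T) :
  [seq F u | u <- enum S] = [seq F (elt s i) | i <- iota 0 #|S|].
Proof. by rewrite -(map_elt s) -map_comp. Qed.

Lemma rows_clsE : rows_cls M = [seq bits #|S| (clsN M s i) | i <- iota 0 #|S|].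
Proof. by rewrite /rows_cls map_enum; apply: eq_map => i; rewrite map_enum. Qed.

Lemma rows_prefE : rows_pref M = [seq bits #|S| (prfN M s i) | i <- iota 0 #|S|].
Proof. by rewrite /rows_pref map_enum; apply: eq_map => i; rewrite map_enum. Qed.

Lemma card_adj i : #|[pred v | acc M (elt s i) v]| = size (adjN M s i).
Proof. by rewrite /adjN size_map enumT cardE. Qed.

Lemma rows_accE : rows_acc M = [seq size (adjN M s i) :: adjN M s i | i <- iota 0 #|S|].
Proof. by rewrite /rows_acc map_enum; apply: eq_map => i; rewrite card_adj. Qed.

Lemma rows_valE : rows_val M a = [seq bits #|S| f | f <- valsN M s (nvars a)].
Proof. by rewrite /rows_val /valsN -map_comp; apply: eq_map => p; rewrite map_enum. Qed.

(** Links the cost of a belief node, a sum of list lengths, to the number of pairs in the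
    accessibility relation. *)
Lemma sum_adj : \sum_(i < #|S|) size (adjN M s i) = nacc M.
Proof.
rewrite /nacc; transitivity (\sum_(u in S) \sum_(v | acc M u v) 1);
  last by rewrite pair_big_dep -sum1_card; apply: eq_bigl.
rewrite -[RHS]big_enum (big_nth s) -[size _]cardE big_mkord; apply: eq_bigr => i _.
by rewrite sum1_card -card_adj.
Qed.

Lemma input_tables :
  let tbl := table (input_mem M s a) (addrF M a) in
  [/\ tbl addrA [seq bits #|S| (clsN M s i) | i <- iota 0 #|S|],
      tbl (addrP M) [seq bits #|S| (prfN M s i) | i <- iota 0 #|S|],
      tbl (addrR M) [seq size (adjN M s i) :: adjN M s i | i <- iota 0 #|S|] &
      tbl (addrV M) [seq bits #|S| f | f <- valsN M s (nvars a)]].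
Proof.
rewrite /= -rows_clsE -rows_prefE -rows_accE -rows_valE /input_mem /input.
set hd := [:: 0, _ & _].
have EF : addrF M a = 10 + size (blockA M) + size (blockP M) + size (blockR M) + size (blockV M a).
  by [].
have S10 : size hd = 10 by [].
split.
- apply: table_encode_rows => //; rewrite EF -/(blockA M) /addrA; lia.
- rewrite catA; apply: table_encode_rows; first by rewrite size_cat S10.
    by rewrite /addrP /addrA; lia.
  by rewrite EF -/(blockP M) /addrP /addrA; lia.
- rewrite 2!catA; apply: table_encode_rows; first by rewrite 2!size_cat S10.
    by rewrite /addrR /addrP /addrA; lia.
  by rewrite EF -/(blockR M) /addrR /addrP /addrA; lia.
rewrite 3!catA; apply: table_encode_rows; first by rewrite 3!size_cat S10.
  by rewrite /addrV /addrR /addrP /addrA; lia.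
by rewrite EF -/(blockV M a) /addrV /addrR /addrP /addrA; lia.
Qed.

Lemma inputE : exists2 pre, size pre = addrF M a & input M s a = pre ++ blockF M a.
Proof.
rewrite /input; set hd := [:: 0, _ & _].
exists ((((hd ++ blockA M) ++ blockP M) ++ blockR M) ++ blockV M a).
  by rewrite 4!size_cat.
by rewrite 4!catA.
Qed.

Lemma input_beyond x : input_len M a <= x -> input_mem M s a x = 0.
Proof.
move=> Hx; rewrite /input_mem nth_default //.
by have [pre Hp ->] := inputE; rewrite size_cat Hp.
Qed.

Lemma input_formula i : i < size (blockF M a) ->
  input_mem M s a (addrF M a + i) = nth 0 (enc_t a (addrF M a)) i.
Proof.
move=> Hi; rewrite /input_mem; have [pre Hp ->] := inputE.
by rewrite nth_cat Hp ltnNge leq_addr /= addKn.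
Qed.

Lemma init_tri : addrF M a <= input_len M a -> 10 <= addrF M a ->
  tri (input_len M a) init (fun=> 0, input_mem M s a) 7 (fun st : state =>
   [/\ loop_inv (input_len M a) #|S| (addrP M) (addrR M) (addrV M) (addrF M a)
         (input_mem M s a) st,
       st.1 rNode = input_len M a & st.2 = input_mem M s a]).
Proof.
move=> HL A10; have fr x : x \in [:: 1; 3; 5; 6; 7] -> cell_free (input_len M a) x.
  by rewrite !inE /cell_free; lia.
do 5 (apply: tri_asg_seq; first exact: fr; rewrite [ev _ _ _]/=).
apply: tri_asg_seq => //; apply: tri_asg => //; rewrite [ev _ _ _]/=.
split=> //; split=> // x Hx; apply: input_beyond.
by apply: leq_trans Hx; rewrite /= /upd /= leq_addr.
Qed.

Lemma checker_tri : let L := input_len M a in let n := #|S| in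
  tri L checker (fun=> 0, input_mem M s a)
    (100 * ((tconn a + nbel a) * (1 + n + nacc M)) + 100 * (nsup a * (n ^ 2 + n + 1)) + 48)
    (fun st' : state => [/\ st'.1 rRoot = addrF M a, st'.2 2 = st_idx s, addrF M a < L,
       10 <= addrF M a &
       is_row L n (addrF M a) st' (st'.2 (addrF M a)) (fun i => tsat M a (elt s i))]).
Proof.
move=> L n; have [TA TP TR TV] := input_tables.
have HL : addrF M a <= L by rewrite /L /input_len leq_addr.
have A10 : 10 <= addrF M a by case: TA; rewrite /addrA; lia.
have [Hs Hp] := proc_t HL TA TP TR TV (addrF M a) (all_tvars_nvars a).
rewrite sum_adj in Hp.
(* 48 = 7 + 40 + 1: the assignments of [init], the constant of [proc_t] and the failing test of the
   main loop. *)
set T := _ + 40 in Hp; rewrite (_ : _ + 48 = (7 + (T + 1))); last by rewrite /T; lia.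
have EL : L = addrF M a + 3 * tsz a by rewrite -Hs.
have T0 := tsz_gt0 a.
apply: tri_seq; apply: tri_weaken (init_tri HL A10) (leqnn _) _ => st [Hi HN HM].
have HF : L + 40 <= st.1 rFree by case: Hi.
apply: Hp => //.
- by rewrite EL.
- by rewrite -EL.
- by move=> i Hi'; rewrite HM; apply: input_formula; rewrite /blockF Hs.
move=> st' [I1 N1 R1 M1 G1].
have E1 : st'.1 rRoot = addrF M a by case: I1 => [[]].
apply: tri_while0 => //=; first by rewrite N1 E1 subnn.
split=> //; last lia.
by rewrite M1 ?HM //; lia.
Qed.

End Input.

(** * The time bound on the machine *)

Theorem theorem7 :
  exists (P : program) (c : nat),
    forall (S : finType) (I : eqType) (M : trust_model S I) (s : S) (a : tform),
      let n := #|S| in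
      let r := nacc M in
      let k := nsup a in
      let k' := kprime a in
      exists m' : memory,
        exec P (c * (k * n ^ 2 + (k + k') * (n + r)) + c) (0, input_mem M s a) = Some m'
        /\ m' 0 = nat_of_bool (tsat M a s).
Proof.
pose W := (csize checker).+1; pose A := size (comp_expr answer 0).
(* With X the bracket of the bound, the run takes at most W * (200 * X + 48) + A steps; this
   constant covers both the coefficient of X and the remainder. *)
exists checker_program, (200 * W + A) => S I M s a n r k k'.
have n_gt0 : 0 < n by apply/card_gt0P; exists s.
have [t [st [Hrun Ht [ER E2 FL F10 Hrow]]]] := checker_tri M s a.
set L := input_len M a in Hrun FL Hrow; set m := input_mem M s a in Hrun *.
have L9 : 9 < L by lia.
have Hrep : rep L m (fun=> 0, m).
  (* Cells past the input read as 0, so the virtual registers start at 0. *)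
  by split=> // j _; apply: input_beyond; rewrite leq_addr.
have /andP [wfc wfa] := wf_checker.
have code1 : code_at checker_program 0 (compile checker 0) by apply: code_at_self.
have [k1 [m1 [K1 R1 L1]]] := comp_run L9 Hrun wfc code1 (leqnn W) Hrep.
rewrite add0n in K1.
have idx := idx_lt s.
have safe_ans : safe L st answer.
  rewrite /= ER E2 (row_free (ltnW FL) Hrow idx) /cell_free; lia.
have [E1 _ _] := comp_exprP L9 R1 wfa safe_ans.
have [|_ code2] := @code_at_cat checker_program 0 (compile checker 0) (comp_expr answer 0).
  by move=> i _; rewrite add0n.
rewrite add0n size_comp in code2.
have K2 := nsteps_straight m1 code2 (straight_expr _ _).
set m2 := foldl _ _ _ in E1 K2; exists m2; split; last first.
  by rewrite E1 /= ER E2; case: Hrow => _ -> //; rewrite elt_idx.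
apply: exec_nsteps (nsteps_add K1 K2) _ _.
  (* The machine stops by running off the end of the program, where [nth] defaults to [IHalt]. *)
  by rewrite /step nth_default // size_cat size_comp.
have Hk : tconn a + nbel a <= k' by rewrite /k' /kprime; lia.
rewrite -/n -/r -/k -/A in Ht *.
have Ht' : t <= 200 * (k * n ^ 2 + (k + k') * (n + r)) + 48.
  (* Since [s] is a state, n is positive and 1 + n + r is at most 2 * (n + r); this doubles the 100
     of [checker_tri] to 200. *)
  have : (tconn a + nbel a) * (1 + n + r) <= k' * (2 * (n + r)) by apply: leq_mul; lia.
  have : k * (n ^ 2 + n + 1) <= k * (n ^ 2 + 2 * (n + r)) by rewrite leq_mul2l; lia.
  lia.
set X := _ + _ * _ in Ht' *.
have : W * t <= W * (200 * X + 48) by rewrite leq_mul2l Ht' orbT.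
have : 0 < W by [].
clearbody W A X; nia.
Qed.
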